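(* Let $g:\mathbb{N}\to\mathbb{C}$ be an arithmetic function with $g(n)\ll 1$ for all $n\geq 1$, and let $f=\mathrm{id}\ast g$, i.e. $f(n)=\sum_{d\mid n} d\, g(n/d)$. Then \[ \sum_{n\leq x}\frac{f([x/n])}{[x/n]}=x\sum_{m\geq1}\frac{f(m)}{m^2(m+1)}+O(x^{1/3}\log x) \] as $x\rightarrow\infty$.
   Context: $[t]$ denotes the integral part of the real number $t$; $\mathrm{id}(n)=n$ for $n\ge1$, and $\ast$ denotes Dirichlet convolution. *)

(* Defs.v *)
From Stdlib Require Import Reals Arith List Lia.
From Coquelicot Require Import Coquelicot.
Import ListNotations.
Open Scope R_scope.

(* floor of a real t, as a natural number (meaningful for t >= 0):
   Int_part t is the integral part [t] (largest integer <= t). *)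
Definition fl (t : R) : nat := Z.to_nat (Int_part t).

Definition id_conv (g : nat -> C) (n : nat) : C :=
  fold_right Cplus (RtoC 0)
    (map (fun d => if Nat.eqb (n mod d) 0
                   then Cmult (RtoC (INR d)) (g (n / d)%nat)
                   else RtoC 0)
         (seq 1 n)).

Definition Ssum (f : nat -> C) (x : R) : C :=
  fold_right Cplus (RtoC 0)
    (map (fun n => Cdiv (f (fl (x / INR n))) (RtoC (INR (fl (x / INR n)))))
         (seq 1 (fl x))).

(* m-th term (m >= 1) of the constant series, shifted to start at index 0:
   term k = f(k+1) / ((k+1)^2 (k+2)). *)
Definition series_term (f : nat -> C) (k : nat) : C :=
  Cdiv (f (S k)) (RtoC (INR (S k) ^ 2 * INR (S (S k)))).

(* Main.v *)
(* Write h(m) = f(m)/m = sum over k | m of g(k)/k. The sum is then the sum over k of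
   g(k)/k times the number of n <= x with k | [x/n], so it is enough to count the latter
   with an error O(y^(1/3) (1 + log y)), y = x/k; the factor k^(-1/3) makes the sum over k
   converge. The hyperbola method, split at sqrt y, expresses this error by sums of the
   sawtooth psi(y/(n + th) + c) over n <= sqrt y, as in Voronoi's divisor problem.

   A dyadic piece n in [M, 2M] costs only O(y^(1/3)): put lam = y/M^3, the size of the
   second derivative. If the slope at n is within 1/q^2 of a reduced fraction a/q, the
   next q terms form a block whose sawtooth sum is O(1 + lam q^3). With Q = lam^(-1/3) and
   a Dirichlet approximation a/q, q <= Q, rho = |q slope - a|, take the block length q if
   rho^2 <= lam q, and otherwise the denominator, of order 1/rho, of the next
   approximation. In both cases the block sum is dominated by the sum over the block of
   lam/(lam q + (q slope - a)^2). Summed over n, then over all a and q <= Q, these weights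
   give O(y^(1/3)) without the logarithm that blocks of length q alone would produce. *)
Require Import Defs.
From Stdlib Require Import Reals Lra Lia Psatz ZArith Arith List Permutation Classical.
From Coquelicot Require Import Coquelicot.
Open Scope R_scope.

(** * Finite sums *)

Fixpoint rsum (n : nat) (F : nat -> R) : R :=
  match n with O => 0 | S k => rsum k F + F k end.

Lemma rsum_ext (n : nat) (F G : nat -> R) :
  (forall i, (i < n)%nat -> F i = G i) -> rsum n F = rsum n G.
Proof.
  induction n as [|n IH]; intros H; simpl; [easy|].
  rewrite IH, (H n) by (intros; try apply H; lia). easy.
Qed.

Lemma rsum_le (n : nat) (F G : nat -> R) :
  (forall i, (i < n)%nat -> F i <= G i) -> rsum n F <= rsum n G.
Proof.
  induction n as [|n IH]; intros H; simpl; [lra|].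
  apply Rplus_le_compat; [apply IH; intros; apply H; lia|apply H; lia].
Qed.

Lemma rsum_const (n : nat) (c : R) : rsum n (fun _ => c) = INR n * c.
Proof.
  induction n as [|n IH]; [simpl; ring|].
  change (rsum n (fun _ => c) + c = INR (S n) * c). rewrite IH, S_INR. ring.
Qed.

Lemma rsum_nonneg (n : nat) (F : nat -> R) :
  (forall i, (i < n)%nat -> 0 <= F i) -> 0 <= rsum n F.
Proof.
  intros H. replace 0 with (rsum n (fun _ => 0)) by (rewrite rsum_const; ring).
  apply rsum_le; easy.
Qed.

Lemma rsum_plus (n : nat) (F G : nat -> R) :
  rsum n (fun i => F i + G i) = rsum n F + rsum n G.
Proof. induction n as [|n IH]; simpl; [ring|rewrite IH; ring]. Qed.

Lemma rsum_minus (n : nat) (F G : nat -> R) :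
  rsum n (fun i => F i - G i) = rsum n F - rsum n G.
Proof. induction n as [|n IH]; simpl; [ring|rewrite IH; ring]. Qed.

Lemma rsum_scal (n : nat) (c : R) (F : nat -> R) :
  rsum n (fun i => c * F i) = c * rsum n F.
Proof. induction n as [|n IH]; simpl; [ring|rewrite IH; ring]. Qed.

Lemma rsum_abs (n : nat) (F : nat -> R) :
  Rabs (rsum n F) <= rsum n (fun i => Rabs (F i)).
Proof.
  induction n as [|n IH]; simpl; [rewrite Rabs_R0; lra|].
  eapply Rle_trans; [apply Rabs_triang|lra].
Qed.

Lemma rsum_split (n m : nat) (F : nat -> R) :
  rsum (n + m) F = rsum n F + rsum m (fun i => F (n + i)%nat).
Proof.
  induction m as [|m IH]; [rewrite Nat.add_0_r; simpl; ring|].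
  rewrite Nat.add_succ_r. simpl. rewrite IH. ring.
Qed.

Lemma rsum_first (n : nat) (F : nat -> R) :
  rsum (S n) F = F O + rsum n (fun i => F (S i)).
Proof. change (S n) with (1 + n)%nat. rewrite rsum_split. simpl. ring. Qed.

Lemma rsum_switch (n m : nat) (F : nat -> nat -> R) :
  rsum n (fun i => rsum m (fun j => F i j)) = rsum m (fun j => rsum n (fun i => F i j)).
Proof.
  induction n as [|n IH]; simpl; [rewrite rsum_const; ring|].
  rewrite IH, <- rsum_plus. easy.
Qed.

Lemma rsum_term_le (n k : nat) (F : nat -> R) :
  (k < n)%nat -> (forall i, (i < n)%nat -> 0 <= F i) -> F k <= rsum n F.
Proof.
  intros Hk H. replace n with (k + S (n - S k))%nat by lia.
  rewrite rsum_split, rsum_first, Nat.add_0_r.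
  assert (0 <= rsum k F) by (apply rsum_nonneg; intros; apply H; lia).
  assert (0 <= rsum (n - S k) (fun i => F (k + S i)%nat))
    by (apply rsum_nonneg; intros; apply H; lia).
  lra.
Qed.

Lemma rsum_telescope (n : nat) (F : nat -> R) :
  rsum n (fun i => F i - F (S i)) = F O - F n.
Proof. induction n as [|n IH]; simpl; [ring|rewrite IH; ring]. Qed.

Lemma rsum_seq (s n : nat) (F : nat -> R) :
  fold_right Rplus 0 (map F (seq s n)) = rsum n (fun i => F (s + i)%nat).
Proof.
  revert s; induction n as [|n IH]; intros s; [easy|].
  rewrite rsum_first. simpl. rewrite IH, Nat.add_0_r. f_equal.
  apply rsum_ext; intros; f_equal; lia.
Qed.

Lemma fold_right_Rplus_perm (l l' : list R) :
  Permutation l l' -> fold_right Rplus 0 l = fold_right Rplus 0 l'.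
Proof. induction 1; simpl; lra. Qed.

Lemma rsum_id (n : nat) : rsum n INR = INR n * (INR n - 1) / 2.
Proof.
  induction n as [|n IH]; [simpl; field|].
  change (rsum n INR + INR n = INR (S n) * (INR (S n) - 1) / 2).
  rewrite IH, S_INR. field.
Qed.

(** * The sawtooth function along nearly arithmetic progressions *)

Definition psi (u : R) : R := u - IZR (Int_part u) - 1 / 2.

Lemma Int_part_bounds (u : R) : IZR (Int_part u) <= u < IZR (Int_part u) + 1.
Proof. destruct (base_Int_part u). lra. Qed.

Lemma Int_part_unique (u : R) (z : Z) : IZR z <= u < IZR z + 1 -> Int_part u = z.
Proof. intros H. symmetry. apply Int_part_spec. lra. Qed.

Lemma Int_part_le (u v : R) : u <= v -> (Int_part u <= Int_part v)%Z.
Proof.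
  intros H. destruct (Int_part_bounds u), (Int_part_bounds v).
  assert (IZR (Int_part u) < IZR (Int_part v + 1)) by (rewrite plus_IZR; lra).
  apply lt_IZR in H4. lia.
Qed.

Lemma psi_bound (u : R) : Rabs (psi u) <= 1 / 2.
Proof. unfold psi. destruct (Int_part_bounds u). apply Rabs_le. lra. Qed.

(** All jumps of [psi] go downwards, because [Int_part] is monotone. *)
Lemma psi_add_le (u t : R) : 0 <= t -> psi (u + t) <= psi u + t.
Proof.
  intros H. unfold psi.
  assert (IZR (Int_part u) <= IZR (Int_part (u + t))) by (apply IZR_le, Int_part_le; lra).
  lra.
Qed.

Lemma psi_rsum_trivial (n : nat) (v : nat -> R) :
  Rabs (rsum n (fun t => psi (v t))) <= INR n / 2.
Proof.
  eapply Rle_trans; [apply rsum_abs|].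
  eapply Rle_trans; [apply rsum_le; intros; apply psi_bound|].
  rewrite rsum_const. lra.
Qed.

(** As a is prime to q, t -> k + a t permutes the residues modulo q, so the sum is that of 0, ..., q
    - 1. *)
Lemma rsum_residues (q : nat) (a k : Z) :
  (0 < q)%nat -> Z.gcd a (Z.of_nat q) = 1%Z ->
  rsum q (fun t => IZR ((k + a * Z.of_nat t) mod Z.of_nat q)) = INR q * (INR q - 1) / 2.
Proof.
  intros Hq Hg. rewrite <- rsum_id.
  set (m := fun t => Z.to_nat ((k + a * Z.of_nat t) mod Z.of_nat q)).
  assert (Hm : forall t, (0 <= (k + a * Z.of_nat t) mod Z.of_nat q < Z.of_nat q)%Z)
    by (intros; apply Z.mod_pos_bound; lia).
  transitivity (rsum q (fun t => INR (m t))).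
  { apply rsum_ext; intros i Hi. unfold m. rewrite INR_IZR_INZ, Z2Nat.id; [easy|apply Hm]. }
  change (rsum q (fun t => INR (m (0 + t)%nat)) = rsum q (fun t => INR (0 + t))).
  rewrite <- (rsum_seq 0 q (fun t => INR (m t))), <- (rsum_seq 0 q INR).
  rewrite <- (map_map m INR).
  apply fold_right_Rplus_perm, Permutation_map.
  apply NoDup_Permutation_bis.
  - assert (Hinj : forall l, NoDup l -> incl l (seq 0 q) -> NoDup (map m l)).
    { induction l as [|t l IH]; intros Hn Hl; simpl; [constructor|].
      inversion Hn; subst. constructor.
      - intros Hin. apply in_map_iff in Hin. destruct Hin as [t' [E Ht']].
        assert (T1 : In t (seq 0 q)) by (apply Hl; left; easy).
        assert (T2 : In t' (seq 0 q)) by (apply Hl; right; easy).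
        apply in_seq in T1, T2.
        unfold m in E. apply Z2Nat.inj in E; try apply Hm.
        assert (D : (Z.of_nat q | a * (Z.of_nat t' - Z.of_nat t))%Z).
        { replace (a * (Z.of_nat t' - Z.of_nat t))%Z
            with ((k + a * Z.of_nat t') - (k + a * Z.of_nat t))%Z by ring.
          apply Z.mod_divide; [lia|]. rewrite Zminus_mod, E, Z.sub_diag.
          apply Z.mod_0_l; lia. }
        (* By Gauss q divides t' - t, and both indices are below q, so they agree. *)
        apply Z.gauss in D; [|rewrite Z.gcd_comm; easy].
        destruct D as [c Hc]. assert (c = 0)%Z by nia. subst c.
        assert (t = t') by lia. subst. easy.
      - apply IH; [easy|]. intros z Hz; apply Hl; right; easy. }
    apply Hinj; [apply seq_NoDup|apply incl_refl].
  - rewrite length_map. lia.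
  - intros z Hz. apply in_map_iff in Hz. destruct Hz as [t [E _]]. subst z.
    apply in_seq. specialize (Hm t). unfold m. lia.
Qed.

(** Rounding b down to k/q, with remainder e < 1/q, leaves every floor unchanged. Each term is then
    e - 1/2 plus a residue over q, and the sum is exactly e q - 1/2. *)
Lemma psi_arith_progression (q : nat) (a : Z) (b : R) :
  (0 < q)%nat -> Z.gcd a (Z.of_nat q) = 1%Z ->
  Rabs (rsum q (fun t => psi (b + IZR a * INR t / INR q))) <= 1 / 2.
Proof.
  intros Hq Hg. assert (Hq' : 0 < INR q) by (apply lt_0_INR; easy).
  set (k := Int_part (b * INR q)).
  destruct (Int_part_bounds (b * INR q)) as [K1 K2]. fold k in K1, K2.
  set (e := b - IZR k / INR q).
  assert (He : 0 <= e * INR q < 1)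
    by (unfold e; replace ((b - IZR k / INR q) * INR q) with (b * INR q - IZR k) by (field; lra); lra).
  assert (E : rsum q (fun t => psi (b + IZR a * INR t / INR q))
     = rsum q (fun t => (e - 1 / 2) + / INR q * IZR ((k + a * Z.of_nat t) mod Z.of_nat q))).
  { apply rsum_ext; intros t _.
    set (z := (k + a * Z.of_nat t)%Z).
    assert (Hz : IZR z = IZR (Z.of_nat q) * IZR (z / Z.of_nat q) + IZR (z mod Z.of_nat q)).
    { rewrite <- mult_IZR, <- plus_IZR. f_equal. apply Z.div_mod. lia. }
    assert (Hr : (0 <= z mod Z.of_nat q < Z.of_nat q)%Z) by (apply Z.mod_pos_bound; lia).
    destruct Hr as [R1 R2].
    assert (R2' : (z mod Z.of_nat q + 1 <= Z.of_nat q)%Z) by lia.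
    apply IZR_le in R1, R2'. rewrite plus_IZR in R2'. rewrite <- INR_IZR_INZ in R2', Hz.
    assert (V : b + IZR a * INR t / INR q
      = IZR (z / Z.of_nat q) + (e + / INR q * IZR (z mod Z.of_nat q))).
    { transitivity (e + IZR z / INR q).
      - unfold e, z. rewrite plus_IZR, mult_IZR, <- INR_IZR_INZ. field. lra.
      - rewrite Hz. field. lra. }
    assert (0 <= e + / INR q * IZR (z mod Z.of_nat q) < 1).
    { split; apply Rmult_le_reg_r with (INR q) || apply Rmult_lt_reg_r with (INR q); try lra;
      rewrite Rmult_plus_distr_r, (Rmult_comm (/ INR q)), Rmult_assoc, Rinv_l; lra. }
    unfold psi. rewrite V at 2. rewrite (Int_part_unique _ (z / Z.of_nat q)) by lra.
    rewrite V. ring. }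
  rewrite E, rsum_plus, rsum_const, rsum_scal, rsum_residues by easy.
  replace (INR q * (e - 1 / 2) + / INR q * (INR q * (INR q - 1) / 2)) with (e * INR q - 1 / 2)
    by (field; lra).
  apply Rabs_le. lra.
Qed.

(* psi can increase at most as fast as the identity, so a perturbation of size E
   costs 2E per term after shifting the whole progression by E; no count of the
   terms lying close to an integer is needed. *)
Lemma psi_block (q : nat) (a : Z) (b E : R) (v : nat -> R) :
  (0 < q)%nat -> Z.gcd a (Z.of_nat q) = 1%Z ->
  (forall t, (t < q)%nat -> Rabs (v t - (b + IZR a * INR t / INR q)) <= E) ->
  Rabs (rsum q (fun t => psi (v t))) <= 1 / 2 + 2 * E * INR q.
Proof.
  intros Hq Hg Hv.
  pose proof (psi_arith_progression q a (b - E) Hq Hg) as P1.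
  pose proof (psi_arith_progression q a (b + E) Hq Hg) as P2.
  apply Rabs_le_between in P1, P2. apply Rabs_le. split.
  - assert (rsum q (fun t => psi (b + E + IZR a * INR t / INR q) - 2 * E)
            <= rsum q (fun t => psi (v t))).
    { apply rsum_le; intros t Ht. specialize (Hv t Ht). apply Rabs_le_between in Hv.
      pose proof (psi_add_le (v t) (b + E + IZR a * INR t / INR q - v t)) as H.
      replace (v t + (b + E + IZR a * INR t / INR q - v t)) with (b + E + IZR a * INR t / INR q) in H by ring.
      lra. }
    rewrite rsum_minus, rsum_const in H. lra.
  - assert (rsum q (fun t => psi (v t))
            <= rsum q (fun t => psi (b - E + IZR a * INR t / INR q) + 2 * E)).
    { apply rsum_le; intros t Ht. specialize (Hv t Ht). apply Rabs_le_between in Hv.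
      pose proof (psi_add_le (b - E + IZR a * INR t / INR q) (v t - (b - E + IZR a * INR t / INR q))) as H.
      replace (b - E + IZR a * INR t / INR q + (v t - (b - E + IZR a * INR t / INR q))) with (v t) in H by ring.
      lra. }
    rewrite rsum_plus, rsum_const in H. lra.
Qed.

(** * Rational approximation *)

Lemma pigeonhole (n : nat) (f : nat -> nat) :
  (forall i, (i <= n)%nat -> (f i < n)%nat) ->
  exists i j, (i < j <= n)%nat /\ f i = f j.
Proof.
  intros H. apply NNPP. intros Hno.
  assert (N : NoDup (map f (seq 0 (S n)))).
  { apply NoDup_nth with (d := f O). intros i j Hi Hj E.
    rewrite length_map, length_seq in Hi, Hj. rewrite !map_nth, !seq_nth in E by easy.
    simpl in E. destruct (Nat.lt_trichotomy i j) as [L|[L|L]]; [|easy|];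
    exfalso; apply Hno; [exists i, j|exists j, i]; split; auto; lia. }
  assert (I : incl (map f (seq 0 (S n))) (seq 0 n)).
  { intros z Hz. apply in_map_iff in Hz. destruct Hz as [t [<- Ht]].
    apply in_seq in Ht. apply in_seq. specialize (H t). lia. }
  pose proof (NoDup_incl_length N I) as L. rewrite length_map, !length_seq in L. lia.
Qed.

(** Cut [0, 1) into N + 1 boxes and place the fractional parts of i al, 0 <= i <= N. If some i hits
    the last box, i al is within 1/(N + 1) of the next integer; otherwise N + 1 points share N
    boxes, and the difference of two colliding indices is the denominator. *)
Lemma dirichlet (al : R) (N : nat) : (1 <= N)%nat ->
  exists (q : nat) (a : Z), (1 <= q <= N)%nat /\ Rabs (INR q * al - IZR a) * INR (S N) <= 1.
Proof.
  intros HN.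
  set (bx := fun i : nat => Int_part ((INR i * al - IZR (Int_part (INR i * al))) * INR (S N))).
  assert (HS : 0 < INR (S N)) by (apply lt_0_INR; lia).
  assert (Hb : forall i, (0 <= bx i <= Z.of_nat N)%Z).
  { intros i. unfold bx. destruct (Int_part_bounds (INR i * al)) as [H1 H2].
    set (fr := INR i * al - IZR (Int_part (INR i * al))) in *.
    assert (0 <= fr * INR (S N) < INR (S N)) by (unfold fr; split; nra).
    destruct (Int_part_bounds (fr * INR (S N))) as [H3 H4].
    split.
    - apply Z.lt_succ_r, lt_IZR. unfold Z.succ. rewrite plus_IZR. lra.
    - apply Z.lt_succ_r, lt_IZR. rewrite <- Nat2Z.inj_succ, <- INR_IZR_INZ. lra. }
  destruct (classic (exists i, (i <= N)%nat /\ bx i = Z.of_nat N)) as [[i [Hi E]]|Hno].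
  - exists i, (Int_part (INR i * al) + 1)%Z. split.
    (* The index 0 falls into box 0, which is not the last one since N >= 1. *)
    + destruct i; [|lia]. exfalso. unfold bx in E. simpl (INR 0) in E.
      rewrite Rmult_0_l in E. rewrite (Int_part_unique 0 0) in E by lra.
      rewrite Rminus_diag, Rmult_0_l, (Int_part_unique 0 0) in E by lra. lia.
    + unfold bx in E. destruct (Int_part_bounds (INR i * al)) as [H1 H2].
      set (fr := INR i * al - IZR (Int_part (INR i * al))) in *.
      destruct (Int_part_bounds (fr * INR (S N))) as [H3 H4]. rewrite E, <- INR_IZR_INZ in H3.
      rewrite plus_IZR, Rabs_left1 by lra.
      rewrite S_INR in *. replace (INR i * al - (IZR (Int_part (INR i * al)) + 1)) with (fr - 1) by (unfold fr; ring).
      nra.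
  - destruct (pigeonhole N (fun i => Z.to_nat (bx i))) as [i [j [Hij E]]].
    { intros i Hi. specialize (Hb i). assert (bx i <> Z.of_nat N) by (intros ?; apply Hno; exists i; easy). lia. }
    apply Z2Nat.inj in E; try apply Hb.
    exists (j - i)%nat, (Int_part (INR j * al) - Int_part (INR i * al))%Z. split; [lia|].
    unfold bx in E. rewrite minus_IZR, minus_INR by lia.
    set (fi := INR i * al - IZR (Int_part (INR i * al))) in *.
    set (fj := INR j * al - IZR (Int_part (INR j * al))) in *.
    replace ((INR j - INR i) * al - (IZR (Int_part (INR j * al)) - IZR (Int_part (INR i * al)))) with (fj - fi) by (unfold fi, fj; ring).
    destruct (Int_part_bounds (fi * INR (S N))), (Int_part_bounds (fj * INR (S N))).
    rewrite E in *. rewrite <- (Rabs_right (INR (S N))), <- Rabs_mult by lra.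
    apply Rabs_le. lra.
Qed.

(** The integer N = [Q] satisfies N + 1 > Q, which gives the bound with Q. Cancelling the gcd g
    divides both the denominator and the error by g, so both bounds survive. *)
Lemma dirichlet_coprime (al Q : R) : 1 <= Q ->
  exists (q : nat) (a : Z), (1 <= q)%nat /\ INR q <= Q /\
    Rabs (INR q * al - IZR a) * Q <= 1 /\ Z.gcd a (Z.of_nat q) = 1%Z.
Proof.
  intros HQ. destruct (Int_part_bounds Q) as [H1 H2].
  assert (HN : (1 <= Int_part Q)%Z).
  { apply Z.lt_succ_r, lt_IZR. unfold Z.succ. rewrite plus_IZR. lra. }
  destruct (dirichlet al (Z.to_nat (Int_part Q))) as [q [a [Hq Ha]]]; [lia|].
  rewrite S_INR, (INR_IZR_INZ (Z.to_nat _)), Z2Nat.id in Ha by lia.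
  remember (Z.gcd a (Z.of_nat q)) as g eqn:Eg.
  assert (Hg0 : (0 < g)%Z).
  { pose proof (Z.gcd_nonneg a (Z.of_nat q)).
    assert (Z.gcd a (Z.of_nat q) <> 0)%Z by (rewrite Z.gcd_eq_0; lia). lia. }
  pose proof (Z.gcd_divide_l a (Z.of_nat q)) as Da.
  pose proof (Z.gcd_divide_r a (Z.of_nat q)) as Dq.
  rewrite <- Eg in Da, Dq. destruct Da as [a1 Ea], Dq as [q1 Eq].
  assert (Hc : Z.gcd a1 q1 = 1%Z).
  { replace a1 with (a / g)%Z by (rewrite Ea; apply Z.div_mul; lia).
    replace q1 with (Z.of_nat q / g)%Z by (rewrite Eq; apply Z.div_mul; lia).
    apply Z.gcd_div_gcd; [lia|easy]. }
  assert (1 <= q1)%Z by nia.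
  exists (Z.to_nat q1), a1. rewrite Z2Nat.id, INR_IZR_INZ, Z2Nat.id by lia.
  split; [lia|]. split.
  - apply Rle_trans with (IZR (Int_part Q)); [|lra]. apply IZR_le. nia.
  - split; [|easy].
    assert (E : INR q * al - IZR a = IZR g * (IZR q1 * al - IZR a1))
      by (rewrite INR_IZR_INZ, Ea, Eq, !mult_IZR; ring).
    rewrite E, Rabs_mult, (Rabs_right (IZR g)) in Ha by (apply Rle_ge, IZR_le; lia).
    assert (1 <= IZR g) by (apply IZR_le; lia).
    pose proof (Rabs_pos (IZR q1 * al - IZR a1)). 
    apply Rle_trans with (IZR g * Rabs (IZR q1 * al - IZR a1) * (IZR (Int_part Q) + 1)); [|easy].
    apply Rmult_le_compat; nra.
Qed.

(** * Blocks adapted to the slope *)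

(** Two errors enter [psi_block]: replacing al by a/q costs at most |q al - a| over q steps, and
    curvature costs at most lam q^2. The linear model has slope - al, hence the numerator - a. *)
Lemma psi_block_slope (q : nat) (a : Z) (al lam : R) (v : nat -> R) :
  (0 < q)%nat -> Z.gcd a (Z.of_nat q) = 1%Z -> 0 <= lam ->
  (forall t, Rabs (v t - (v O - al * INR t)) <= lam * INR t ^ 2) ->
  Rabs (rsum q (fun t => psi (v t)))
    <= 1 / 2 + 2 * (Rabs (INR q * al - IZR a) + lam * INR q ^ 2) * INR q.
Proof.
  intros Hq Hg Hl Hv.
  assert (Hq' : 0 < INR q) by (apply lt_0_INR; easy).
  apply (psi_block q (- a) (v O)); [easy|rewrite Z.gcd_opp_l; easy|].
  intros t Ht. specialize (Hv t).
  assert (T0 : 0 <= INR t) by apply pos_INR.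
  assert (T1 : INR t <= INR q) by (apply le_INR; lia).
  set (rho := Rabs (INR q * al - IZR a)).
  replace (v t - (v O + IZR (- a) * INR t / INR q))
    with ((v t - (v O - al * INR t)) + (- (INR q * al - IZR a)) * (INR t / INR q))
    by (rewrite opp_IZR; field; lra).
  eapply Rle_trans; [apply Rabs_triang|].
  rewrite Rabs_mult, Rabs_Ropp. fold rho.
  assert (0 <= rho) by apply Rabs_pos.
  assert (0 <= INR t / INR q <= 1).
  { split; [apply Rdiv_le_0_compat; lra|]. apply Rmult_le_reg_r with (INR q); [lra|].
    unfold Rdiv. rewrite Rmult_assoc, Rinv_l; lra. }
  rewrite (Rabs_right (INR t / INR q)) by lra.
  assert (lam * INR t ^ 2 <= lam * INR q ^ 2) by (apply Rmult_le_compat_l; [lra|apply pow_incr; lra]).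
  nra.
Qed.

(* If the convergent a/q of the slope is good, a block of length q suffices; otherwise
   the next approximation b/q', with q' of order 1/rho, gives the block. *)
Lemma good_block (lam Q : R) (v sl : nat -> R) :
  0 < lam -> 1 <= Q -> lam * Q ^ 3 = 1 ->
  (forall t, Rabs (v t - (v O - sl O * INR t)) <= lam * INR t ^ 2) ->
  (forall t, Rabs (sl t - sl O) <= 2 * lam * INR t) ->
  exists (l q : nat) (a : Z),
    (1 <= l)%nat /\ lam * INR l ^ 2 <= 4 /\ (1 <= q)%nat /\ INR q <= Q /\
    Rabs (INR q * sl O - IZR a) <= 1 /\
    Rabs (rsum l (fun t => psi (v t)))
      <= 1000 * rsum l (fun t => lam / (lam * INR q + (INR q * sl t - IZR a) ^ 2)).
Proof.
  intros Hl HQ HlQ Hv Hs. set (al := sl O) in *.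
  destruct (dirichlet_coprime al Q HQ) as [q [a [Hq1 [HqQ [Hr Hg]]]]].
  assert (Hq : 1 <= INR q) by (change 1 with (INR 1); apply le_INR; lia).
  pose proof (psi_block_slope q a al lam v ltac:(lia) Hg ltac:(lra) Hv) as Hblock.
  set (rho := Rabs (INR q * al - IZR a)) in *.
  assert (Hrho : 0 <= rho) by apply Rabs_pos.
  assert (Hrho1 : rho <= 1) by nra.
  assert (HQ2 : INR q ^ 3 <= Q ^ 3) by (apply pow_incr; lra).
  assert (Hlq3 : lam * INR q ^ 3 <= 1) by (rewrite <- HlQ; apply Rmult_le_compat_l; lra).
  (* The slope drifts by at most 2 lam t from its value at the start of the block, where the
     deviation is [rho]. *)
  assert (Hdev : forall t, (INR q * sl t - IZR a) ^ 2 <= (rho + 2 * lam * INR q * INR t) ^ 2).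
  { intros t. rewrite <- pow2_abs. apply pow_incr. split; [apply Rabs_pos|].
    replace (INR q * sl t - IZR a) with ((INR q * al - IZR a) + INR q * (sl t - al)) by ring.
    eapply Rle_trans; [apply Rabs_triang|]. fold rho. rewrite Rabs_mult, (Rabs_right (INR q)) by lra.
    specialize (Hs t). nra. }
  (* At rho^2 = lam q the two terms of the weight's denominator balance. *)
  destruct (Rle_or_lt (rho ^ 2) (lam * INR q)) as [Hc|Hc].
  - exists q, q, a. repeat split; try easy.
    { assert (lam * INR q ^ 2 <= lam * INR q ^ 3); [|lra]. apply Rmult_le_compat_l; [lra|].
      simpl. nra. }
    (* 9/2 = 1/2 + 2 (1 + 1), from rho q <= 1 and lam q^3 <= 1. *)
    apply Rle_trans with (9 / 2).
    { eapply Rle_trans; [apply Hblock|].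
      assert (rho * INR q <= 1) by nra.
      assert (lam * INR q ^ 2 * INR q <= 1) by (simpl in *; lra). lra. }
    (* With p = lam q^2, the squared deviation is at most (rho + 2 p)^2 <= 9 lam q. Every
       denominator is thus at most 10 lam q, and the q weights add up to at least 1/10. *)
    assert (rsum q (fun _ => / (10 * INR q)) <= rsum q (fun t => lam / (lam * INR q + (INR q * sl t - IZR a) ^ 2))).
    { apply rsum_le. intros t Ht. specialize (Hdev t).
      assert (T1 : INR t <= INR q) by (apply le_INR; lia). pose proof (pos_INR t).
      set (p := lam * INR q * INR q).
      assert (Hp0 : 0 <= p) by (unfold p; apply Rmult_le_pos; [apply Rmult_le_pos|]; lra).
      assert (Hp : p ^ 2 <= lam * INR q).
      { replace (p ^ 2) with ((lam * INR q) * (lam * INR q ^ 3)) by (unfold p; ring).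
        rewrite <- (Rmult_1_r (lam * INR q)) at 2. apply Rmult_le_compat_l; nra. }
      assert (lam * INR q * INR t <= p) by (unfold p; apply Rmult_le_compat_l; nra).
      assert ((rho + 2 * lam * INR q * INR t) ^ 2 <= (rho + 2 * p) ^ 2).
      { apply pow_incr. split; [|lra]. assert (0 <= lam * INR q * INR t) by (repeat apply Rmult_le_pos; lra). lra. }
      assert (rho * p <= lam * INR q) by nra.
      assert (D : lam * INR q + (INR q * sl t - IZR a) ^ 2 <= 10 * (lam * INR q)) by nra.
      assert (0 < lam * INR q) by nra.
      pose proof (pow2_ge_0 (INR q * sl t - IZR a)).
      apply Rle_trans with (lam / (10 * (lam * INR q))).
      - right. field. lra.
      - apply Rmult_le_compat_l; [lra|]. apply Rinv_le_contravar; lra. }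
    rewrite rsum_const in H.
    replace (INR q * / (10 * INR q)) with (1 / 10) in H by (field; lra). lra.
  - assert (Hrho0 : 0 < rho).
    { destruct Hrho as [|E]; [easy|]. rewrite <- E in Hc. assert (0 < lam * INR q) by nra. simpl in Hc. lra. }
    assert (Hir : 0 < / rho) by (apply Rinv_0_lt_compat; easy).
    assert (Hrr : rho * / rho = 1) by (apply Rinv_r; lra).
    (* The bound 2/rho forces rho' <= rho/2, so the new fraction b/q' cannot equal a/q. *)
    destruct (dirichlet_coprime al (2 / rho)) as [q' [b [Hq1' [HqQ' [Hr' Hg']]]]].
    { unfold Rdiv. nra. }
    assert (Hq' : 1 <= INR q') by (change 1 with (INR 1); apply le_INR; lia).
    pose proof (psi_block_slope q' b al lam v ltac:(lia) Hg' ltac:(lra) Hv) as Hblock'.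
    set (rho' := Rabs (INR q' * al - IZR b)) in *.
    assert (Hrho' : 0 <= rho') by apply Rabs_pos.
    assert (Hr2 : rho' <= rho / 2).
    { apply Rmult_le_reg_r with (2 / rho); [unfold Rdiv; lra|].
      replace (rho / 2 * (2 / rho)) with 1 by (field; lra). easy. }
    assert (Hup : INR q' * rho <= 2).
    { apply Rmult_le_reg_r with (/ rho); [easy|]. rewrite Rmult_assoc, Hrr. unfold Rdiv in HqQ'. lra. }
    (* Since b/q' differs from a/q, 1 <= |a q' - b q| <= q' rho + q rho' <= q' rho + 1/2. *)
    assert (Hlow : 1 <= 2 * (INR q' * rho)).
    { assert (Hne : (a * Z.of_nat q' - b * Z.of_nat q <> 0)%Z).
      { intros E.
        assert (Dv : (Z.of_nat q | a * Z.of_nat q')%Z) by (exists b; lia).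
        apply Z.gauss in Dv; [|rewrite Z.gcd_comm; easy]. destruct Dv as [c Ec].
        assert (b = (c * a)%Z) by nia. subst b.
        assert (Ec' : INR q' = IZR c * INR q) by (rewrite !INR_IZR_INZ, Ec, mult_IZR; easy).
        assert (1 <= c)%Z by nia. assert (1 <= IZR c) by (apply IZR_le; easy).
        assert (rho' = IZR c * rho).
        { unfold rho', rho. rewrite Ec', mult_IZR.
          replace (IZR c * INR q * al - IZR c * IZR a) with (IZR c * (INR q * al - IZR a)) by ring.
          rewrite Rabs_mult, (Rabs_right (IZR c)); lra. }
        nra. }
      assert (H1 : 1 <= Rabs (IZR (a * Z.of_nat q' - b * Z.of_nat q))).
      { rewrite <- abs_IZR. apply IZR_le. lia. }
      rewrite minus_IZR, !mult_IZR, <- !INR_IZR_INZ in H1.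
      replace (IZR a * INR q' - IZR b * INR q)
        with (- (INR q' * (INR q * al - IZR a)) + INR q * (INR q' * al - IZR b)) in H1 by ring.
      pose proof (Rabs_triang (- (INR q' * (INR q * al - IZR a))) (INR q * (INR q' * al - IZR b))) as H2.
      rewrite Rabs_Ropp, !Rabs_mult, !(Rabs_right (INR _)) in H2 by lra. fold rho rho' in H2.
      assert (INR q * rho <= 1) by nra. nra. }
    (* As lam Q^3 = 1, the bound rho Q <= 1 becomes rho^3 <= lam; then lam / rho^3 >= 1 absorbs
       bounded terms. *)
    assert (HrQ : rho ^ 3 <= lam).
    { assert (P : (rho * Q) ^ 3 <= 1 ^ 3) by (apply pow_incr; split; [nra|easy]).
      assert (0 < Q ^ 3) by (apply pow_lt; lra).
      apply Rmult_le_reg_r with (Q ^ 3); [easy|]. rewrite HlQ.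
      replace (rho ^ 3 * Q ^ 3) with ((rho * Q) ^ 3) by ring. lra. }
    assert (Hr3 : 0 < rho ^ 3) by (apply pow_lt; easy).
    assert (Hr2' : 0 < rho ^ 2) by (apply pow_lt; easy).
    (* The length comes from the second approximation, while the weights keep the first fraction
       a/q. *)
    exists q', q, a. repeat split; try easy.
    { assert (lam <= lam * INR q) by nra.
      assert ((INR q' * rho) ^ 2 <= 2 ^ 2) by (apply pow_incr; nra).
      apply Rle_trans with (rho ^ 2 * INR q' ^ 2); [|rewrite <- Rpow_mult_distr, (Rmult_comm rho); lra].
      apply Rmult_le_compat_r; [apply pow2_ge_0|lra]. }
    (* The three contributions are 1/2, 2 rho' q' <= 2 and 2 lam q'^3 <= 16 lam / rho^3. *)
    apply Rle_trans with (19 * (lam / rho ^ 3)).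
    { eapply Rle_trans; [apply Hblock'|].
      assert (X1 : 1 <= lam / rho ^ 3).
      { apply Rmult_le_reg_r with (rho ^ 3); [easy|]. unfold Rdiv. rewrite Rmult_assoc, Rinv_l; lra. }
      assert (X2 : lam * INR q' ^ 3 <= 8 * (lam / rho ^ 3)).
      { apply Rmult_le_reg_r with (rho ^ 3); [easy|].
        replace (8 * (lam / rho ^ 3) * rho ^ 3) with (lam * 2 ^ 3) by (field; lra).
        rewrite Rmult_assoc, <- Rpow_mult_distr. apply Rmult_le_compat_l; [lra|].
        apply pow_incr. nra. }
      assert (rho' * INR q' <= 1) by nra.
      simpl in X2 |- *. simpl in X1. lra. }
    (* Here lam q < rho^2 and the deviation is at most 5 rho, whence 26 rho^2. At least 1/(2 rho)
       terms give lam / (52 rho^3) in total, and 19 times 52 is below 1000, the constant of the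
       statement. *)
    assert (rsum q' (fun _ => lam / (26 * rho ^ 2)) <= rsum q' (fun t => lam / (lam * INR q + (INR q * sl t - IZR a) ^ 2))).
    { apply rsum_le. intros t Ht. specialize (Hdev t).
      assert (T1 : INR t <= INR q') by (apply le_INR; lia). pose proof (pos_INR t).
      assert (lam * INR q * INR t <= 2 * rho).
      { apply Rle_trans with (rho ^ 2 * INR q'); [apply Rmult_le_compat; nra|]. simpl. nra. }
      assert ((rho + 2 * lam * INR q * INR t) ^ 2 <= (5 * rho) ^ 2).
      { apply pow_incr. split; [|lra]. assert (0 <= lam * INR q * INR t) by (repeat apply Rmult_le_pos; lra). lra. }
      pose proof (pow2_ge_0 (INR q * sl t - IZR a)).
      assert (0 < lam * INR q) by nra.
      apply Rmult_le_compat_l; [lra|]. apply Rinv_le_contravar; [lra|]. nra. }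
    rewrite rsum_const in H.
    assert (lam / (52 * rho ^ 3) <= INR q' * (lam / (26 * rho ^ 2))).
    { replace (lam / (52 * rho ^ 3)) with (lam / (26 * rho ^ 2) * (1 / (2 * rho))) by (field; lra).
      rewrite Rmult_comm. apply Rmult_le_compat_r.
      - apply Rdiv_le_0_compat; lra.
      - apply Rmult_le_reg_r with (2 * rho); [lra|]. unfold Rdiv. rewrite Rmult_assoc, Rinv_l; lra. }
    replace (lam / (52 * rho ^ 3)) with (lam / rho ^ 3 / 52) in H0 by (field; lra). 
    assert (0 <= lam / rho ^ 3) by (apply Rdiv_le_0_compat; lra). lra.
Qed.

(** Blocks are cut off from the left as long as they fit. The first one to overrun the end leaves
    fewer than L terms, each at most 1/2, which the extra L covers. *)
Lemma greedy_blocks (F W : nat -> R) (C L : R) :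
  (forall n, Rabs (F n) <= 1 / 2) -> (forall n, 0 <= W n) -> 0 <= C ->
  forall T n : nat,
  (forall i, (n <= i < n + T)%nat -> exists l : nat, (1 <= l)%nat /\ INR l <= L /\
     Rabs (rsum l (fun t => F (i + t)%nat)) <= C * rsum l (fun t => W (i + t)%nat)) ->
  0 <= L ->
  Rabs (rsum T (fun t => F (n + t)%nat)) <= C * rsum T (fun t => W (n + t)%nat) + L.
Proof.
  intros HF HW HC T. induction T as [T IH] using (well_founded_induction lt_wf).
  intros n H HL. destruct T as [|T].
  { simpl. rewrite Rabs_R0. lra. }
  destruct (H n) as [l [Hl1 [HlL Hb]]]; [lia|].
  destruct (le_lt_dec l (S T)) as [Hle|Hlt].
  - replace (S T) with (l + (S T - l))%nat by lia. rewrite !rsum_split.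
    assert (Hrest : Rabs (rsum (S T - l) (fun t => F (n + l + t)%nat))
      <= C * rsum (S T - l) (fun t => W (n + l + t)%nat) + L).
    { apply IH; [lia| |easy]. intros i Hi. apply H. lia. }
    rewrite (rsum_ext (S T - l) (fun i => F (n + (l + i))%nat) (fun t => F (n + l + t)%nat))
      by (intros; f_equal; lia).
    rewrite (rsum_ext (S T - l) (fun i => W (n + (l + i))%nat) (fun t => W (n + l + t)%nat))
      by (intros; f_equal; lia).
    eapply Rle_trans; [apply Rabs_triang|]. lra.
  - assert (0 <= C * rsum (S T) (fun t => W (n + t)%nat))
      by (apply Rmult_le_pos; [easy|apply rsum_nonneg; intros; apply HW]).
    eapply Rle_trans; [apply rsum_abs|].
    apply Rle_trans with (rsum (S T) (fun _ => 1 / 2)); [apply rsum_le; intros; apply HF|].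
    rewrite rsum_const. apply lt_INR in Hlt. pose proof (pos_INR (S T)). lra.
Qed.

Lemma Rdiv_le_cross (a b c d : R) : 0 < b -> 0 < d -> a * d <= c * b -> a / b <= c / d.
Proof.
  intros Hb Hd H. apply Rmult_le_reg_r with (b * d); [nra|].
  replace (a / b * (b * d)) with (a * d) by (field; lra).
  replace (c / d * (b * d)) with (c * b) by (field; lra). easy.
Qed.

(** * Sums over separated points *)

(* v / (r + |v|) is a rational substitute for arctan (v / r). *)
Lemma potential_drop (r s v w : R) : 0 < s <= r -> w <= v - s ->
  r * s / (4 * (r ^ 2 + v ^ 2)) <= v / (r + Rabs v) - w / (r + Rabs w).
Proof.
  intros Hs Hw.
  assert (Hmono : w / (r + Rabs w) <= (v - s) / (r + Rabs (v - s))).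
  { unfold Rabs. destruct (Rcase_abs w), (Rcase_abs (v - s)); apply Rdiv_le_cross; nra. }
  apply Rle_trans with (v / (r + Rabs v) - (v - s) / (r + Rabs (v - s))); [|lra].
  clear w Hw Hmono.
  assert (H0 : 0 < r ^ 2 + v ^ 2) by (pose proof (pow2_ge_0 v); nra).
  unfold Rabs. destruct (Rcase_abs v) as [Hv|Hv], (Rcase_abs (v - s)) as [Hvs|Hvs]; [ |exfalso; lra| | ].
  - replace (v / (r + - v) - (v - s) / (r + - (v - s))) with (r * s / ((r - v) * (r - v + s)))
      by (field; lra).
    apply Rdiv_le_cross; [lra|nra|]. apply Rmult_le_compat_l; [nra|].
    apply Rle_trans with ((r - v) * (2 * (r - v))); [apply Rmult_le_compat_l; lra|].
    pose proof (pow2_ge_0 (r + v)). nra.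
  (* Here 0 lies between the two points: v and s - v are in [0, r], so both denominators are at most
     2 r. *)
  - apply Rle_trans with (s / (2 * r)).
    + apply Rdiv_le_cross; [lra|lra|]. nra.
    + replace (v / (r + v) - (v - s) / (r + - (v - s))) with (v / (r + v) + (s - v) / (r + (s - v)))
        by (field; lra).
      apply Rle_trans with (v / (2 * r) + (s - v) / (2 * r)); [right; field; lra|].
      apply Rplus_le_compat; apply Rdiv_le_cross; nra.
  - replace (v / (r + v) - (v - s) / (r + (v - s))) with (r * s / ((r + v) * (r + v - s)))
      by (field; lra).
    apply Rdiv_le_cross; [lra|nra|]. apply Rmult_le_compat_l; [nra|].
    apply Rle_trans with ((r + v) * (r + v)); [apply Rmult_le_compat_l; lra|].
    pose proof (pow2_ge_0 (r - v)). nra.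
Qed.

(** By [potential_drop] each term is at most 4/(r s) times a drop of a function with values in
    [-1, 1]; the drops telescope to at most 2. *)
Lemma separated_sum (r s : R) (v : nat -> R) (T : nat) :
  0 < s <= r -> (forall n, (n < T)%nat -> v (S n) <= v n - s) ->
  rsum T (fun n => / (r ^ 2 + v n ^ 2)) <= 8 / (r * s).
Proof.
  intros Hs Hv.
  assert (Hphi : forall x, Rabs (x / (r + Rabs x)) <= 1).
  { intros x. pose proof (Rabs_pos x).
    rewrite Rabs_div, (Rabs_right (r + Rabs x)) by lra.
    apply Rmult_le_reg_r with (r + Rabs x); [lra|]. unfold Rdiv. rewrite Rmult_assoc, Rinv_l; lra. }
  apply Rle_trans with (rsum T (fun n => 4 / (r * s) *
     (v n / (r + Rabs (v n)) - v (S n) / (r + Rabs (v (S n)))))).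
  - apply rsum_le; intros n Hn. pose proof (potential_drop r s _ _ Hs (Hv n Hn)) as H.
    assert (0 < r ^ 2 + v n ^ 2) by (pose proof (pow2_ge_0 (v n)); nra).
    assert (0 < r * s) by nra.
    apply Rmult_le_compat_l with (r := 4 / (r * s)) in H; [|apply Rdiv_le_0_compat; lra].
    eapply Rle_trans; [|apply H]. right. field. split; lra.
  - rewrite rsum_scal, (rsum_telescope T (fun n => v n / (r + Rabs (v n)))).
    pose proof (Hphi (v O)) as H1. pose proof (Hphi (v T)) as H2.
    apply Rabs_le_between in H1, H2.
    replace (8 / (r * s)) with (4 / (r * s) * 2) by (field; lra).
    apply Rmult_le_compat_l; [apply Rdiv_le_0_compat; nra|lra].
Qed.

Lemma rsum_inv_sqrt (n : nat) : rsum n (fun i => / sqrt (INR (S i))) <= 2 * sqrt (INR n).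
Proof.
  induction n as [|n IH]; [simpl; rewrite sqrt_0; lra|].
  change (rsum n (fun i => / sqrt (INR (S i))) + / sqrt (INR (S n)) <= 2 * sqrt (INR (S n))).
  assert (0 < INR (S n)) by (apply lt_0_INR; lia).
  assert (H1 : 0 < sqrt (INR (S n))) by (apply sqrt_lt_R0; easy).
  assert (H2 : 0 <= sqrt (INR n)) by apply sqrt_pos.
  assert (H3 : sqrt (INR (S n)) * sqrt (INR (S n)) = INR (S n)) by (apply sqrt_sqrt; lra).
  assert (H4 : sqrt (INR n) * sqrt (INR n) = INR n) by (apply sqrt_sqrt, pos_INR).
  rewrite S_INR in *. set (a := sqrt (INR n + 1)) in *. set (b := sqrt (INR n)) in *.
  assert (/ a <= 2 * a - 2 * b); [|lra].
  apply Rmult_le_reg_r with a; [easy|]. rewrite Rinv_l by lra. nra.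
Qed.

(** * Sawtooth sums over a hyperbola *)

(** The remainder is exactly y t^2 / (u^2 (u + t)), with denominator at least m^3. *)
Lemma hyperbola_tangent (y m u t : R) : 0 <= y -> 0 < m <= u -> 0 <= t ->
  Rabs (y / (u + t) - (y / u - y / u ^ 2 * t)) <= y / m ^ 3 * t ^ 2.
Proof.
  intros Hy Hm Ht.
  replace (y / (u + t) - (y / u - y / u ^ 2 * t)) with (y / (u ^ 2 * (u + t)) * t ^ 2) by (field; lra).
  assert (H1 : m ^ 3 <= u ^ 2 * (u + t)).
  { apply Rle_trans with (u ^ 3); [apply pow_incr; lra|]. simpl. nra. }
  assert (H2 : 0 < m ^ 3) by (apply pow_lt; lra).
  assert (H3 : 0 <= t ^ 2) by apply pow2_ge_0.
  assert (0 <= y / (u ^ 2 * (u + t))) by (apply Rdiv_le_0_compat; lra).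
  rewrite Rabs_right by (apply Rle_ge, Rmult_le_pos; lra).
  apply Rmult_le_compat_r; [easy|]. apply Rmult_le_compat_l; [easy|].
  apply Rinv_le_contravar; easy.
Qed.

Lemma slope_drop (y u t : R) : 0 < u -> 0 <= t -> 
  y / u ^ 2 - y / (u + t) ^ 2 = y * t * (2 * u + t) / (u ^ 2 * (u + t) ^ 2).
Proof. intros. field. lra. Qed.

Lemma slope_drop_upper (y m u t : R) : 0 <= y -> 0 < m <= u -> 0 <= t ->
  Rabs (y / (u + t) ^ 2 - y / u ^ 2) <= 2 * (y / m ^ 3) * t.
Proof.
  intros Hy Hm Ht. rewrite Rabs_minus_sym, slope_drop by lra.
  assert (H2 : 0 < m ^ 3) by (apply pow_lt; lra).
  assert (H1 : m ^ 3 <= u ^ 2 * (u + t)).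
  { apply Rle_trans with (u ^ 3); [apply pow_incr; lra|]. simpl. nra. }
  assert (Hyt : 0 <= y * t) by nra.
  rewrite Rabs_right.
  - apply Rle_trans with (2 * (y * t) / (u ^ 2 * (u + t))).
    + replace (u ^ 2 * (u + t) ^ 2) with ((u ^ 2 * (u + t)) * (u + t)) by ring.
      apply Rdiv_le_cross; [nra|lra|].
      replace (2 * (y * t) * (u ^ 2 * (u + t) * (u + t)))
        with ((y * t) * (2 * (u + t)) * (u ^ 2 * (u + t))) by ring.
      apply Rmult_le_compat_r; [lra|]. apply Rmult_le_compat_l; lra.
    + replace (2 * (y / m ^ 3) * t) with (2 * (y * t) / m ^ 3) by (field; lra).
      apply Rmult_le_compat_l; [lra|]. apply Rinv_le_contravar; easy.
  - apply Rle_ge, Rdiv_le_0_compat; [nra|]. apply Rmult_lt_0_compat; apply pow_lt; lra.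
Qed.

(** The drop is at least y t / (u^2 (u + t)), and 64 = 4^3 comes from u + t <= 4 m. This keeps the
    slopes at consecutive integers apart. *)
Lemma slope_drop_lower (y m u t : R) : 0 <= y -> 0 < u -> 0 <= t -> u + t <= 4 * m ->
  y / m ^ 3 / 64 * t <= y / u ^ 2 - y / (u + t) ^ 2.
Proof.
  intros Hy Hu Ht Hm. rewrite slope_drop by lra.
  assert (Hyt : 0 <= y * t) by nra.
  assert (H3 : u ^ 2 * (u + t) <= (4 * m) ^ 3).
  { replace ((4 * m) ^ 3) with ((4 * m) ^ 2 * (4 * m)) by ring.
    apply Rmult_le_compat; [apply pow2_ge_0|lra|apply pow_incr; lra|lra]. }
  assert (0 < u ^ 2) by (apply pow_lt; lra).
  apply Rle_trans with ((y * t) / (u ^ 2 * (u + t))).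
  - replace (y / m ^ 3 / 64 * t) with ((y * t) / (4 * m) ^ 3) by (field; lra).
    apply Rmult_le_compat_l; [easy|]. apply Rinv_le_contravar; [nra|easy].
  - replace (u ^ 2 * (u + t) ^ 2) with ((u ^ 2 * (u + t)) * (u + t)) by ring.
    apply Rdiv_le_cross; [nra|apply Rmult_lt_0_compat; nra|].
    replace (y * t * (u ^ 2 * (u + t) * (u + t)))
      with ((y * t) * (u + t) * (u ^ 2 * (u + t))) by ring.
    apply Rmult_le_compat_r; [nra|]. apply Rmult_le_compat_l; lra.
Qed.

(** A Poisson-kernel bump around the slope a/q, of order 1/q as long as |q slope - a| is at most of
    order sqrt(lam q). Natural numerators suffice because the slopes of the hyperbola are
    positive. *)
Definition weight (lam : R) (sl : nat -> R) (q a n : nat) : R :=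
  lam / (lam * INR q + (INR q * sl n - INR a) ^ 2).

Lemma weight_nonneg (lam : R) (sl : nat -> R) (q a n : nat) :
  0 < lam -> (1 <= q)%nat -> 0 <= weight lam sl q a n.
Proof.
  intros Hl Hq. assert (1 <= INR q) by (change 1 with (INR 1); apply le_INR; lia).
  apply Rdiv_le_0_compat; [lra|]. pose proof (pow2_ge_0 (INR q * sl n - INR a)). nra.
Qed.

(** The numbers q slope - a are separated by lam q / 64, so [separated_sum] applies with r =
    sqrt(lam q); lam q <= 1 ensures that the gap is at most r, and 512 = 8 * 64. *)
Lemma weight_sum (lam : R) (sl : nat -> R) (q a M T : nat) :
  0 < lam -> (1 <= q)%nat -> lam * INR q <= 1 ->
  (forall n, (n < T)%nat -> sl (M + S n)%nat <= sl (M + n)%nat - lam / 64) ->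
  rsum T (fun n => weight lam sl q a (M + n)) <= 512 / (INR q * sqrt (lam * INR q)).
Proof.
  intros Hl Hq Hlq Hs. assert (H1 : 1 <= INR q) by (change 1 with (INR 1); apply le_INR; lia).
  assert (Hp : 0 < lam * INR q) by nra.
  set (r := sqrt (lam * INR q)).
  assert (Hr : 0 < r) by (apply sqrt_lt_R0; easy).
  assert (Hr2 : r * r = lam * INR q) by (apply sqrt_sqrt; lra).
  assert (Hr1 : r <= 1) by nra.
  pose proof (separated_sum r (lam * INR q / 64) (fun n => INR q * sl (M + n)%nat - INR a) T) as H.
  apply Rle_trans with (lam * rsum T (fun n => / (r ^ 2 + (INR q * sl (M + n)%nat - INR a) ^ 2))).
  - rewrite <- rsum_scal. right. apply rsum_ext; intros i _. unfold weight, Rdiv.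
    rewrite <- Hr2. f_equal. f_equal. ring.
  - apply Rle_trans with (lam * (8 / (r * (lam * INR q / 64)))).
    + apply Rmult_le_compat_l; [lra|]. apply H.
      * nra.
      * intros n Hn. specialize (Hs n Hn). nra.
    + right. field. repeat split; lra.
Qed.

(* With lam = k^3/m^3 the second derivative of k^3/u on [m, 2m] is of order lam,
   and Q = m/k is the balancing denominator lam^(-1/3). *)
Lemma dyadic_bound (k th c : R) (M T : nat) :
  1 <= k -> 0 <= th <= 1 -> k <= INR M -> INR M ^ 2 <= k ^ 3 -> (T <= M)%nat ->
  Rabs (rsum T (fun t => psi (k ^ 3 / (INR (M + t) + th) + c))) <= 4000000 * k.
Proof.
  intros Hk Hth HkM HM2 HT.
  set (m := INR M) in *. set (lam := k ^ 3 / m ^ 3). set (Q := m / k).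
  set (sl := fun n : nat => k ^ 3 / (INR n + th) ^ 2).
  assert (Hk3 : 0 < k ^ 3) by (apply pow_lt; lra).
  assert (Hm3 : 0 < m ^ 3) by (apply pow_lt; lra).
  assert (Hlam : 0 < lam) by (apply Rdiv_lt_0_compat; easy).
  assert (HQ : 1 <= Q).
  { apply Rmult_le_reg_r with k; [lra|]. unfold Q, Rdiv. rewrite Rmult_assoc, Rinv_l; lra. }
  assert (HlQ : lam * Q ^ 3 = 1) by (unfold lam, Q; field; lra).
  (* lam m = k^3/m^2 bounds every slope of the range; being at least 1, it absorbs rounding in the
     count of numerators. *)
  assert (Hlm : 1 <= lam * m).
  { replace (lam * m) with (k ^ 3 / m ^ 2) by (unfold lam; field; lra).
    apply Rmult_le_reg_r with (m ^ 2); [apply pow_lt; lra|].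
    replace (k ^ 3 / m ^ 2 * m ^ 2) with (k ^ 3) by (field; lra). lra. }
  (* A numerator within 1 of q times a slope is at most q lam m + 1, hence below [A q]. *)
  set (A := fun q : nat => Z.to_nat (up (INR q * (lam * m) + 1))).
  assert (HA : forall q, (1 <= q)%nat ->
     INR q * (lam * m) + 1 < INR (A q) <= 3 * (INR q * (lam * m))).
  { intros q Hq. assert (1 <= INR q) by (change 1 with (INR 1); apply le_INR; lia).
    destruct (archimed (INR q * (lam * m) + 1)) as [A1 A2].
    assert (0 <= up (INR q * (lam * m) + 1))%Z by (apply le_IZR; nra).
    unfold A. rewrite (INR_IZR_INZ (Z.to_nat _)), Z2Nat.id by easy. split; [lra|]. nra. }
  set (N := Z.to_nat (Int_part Q)).
  destruct (Int_part_bounds Q) as [Q1 Q2].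
  assert (HN0 : (0 <= Int_part Q)%Z).
  { apply Z.lt_succ_r, lt_IZR. unfold Z.succ. rewrite plus_IZR. lra. }
  assert (HNQ : INR N <= Q) by (unfold N; rewrite INR_IZR_INZ, Z2Nat.id by easy; lra).
  assert (HNQ' : forall q, INR q <= Q -> (q <= N)%nat).
  { intros q Hq. unfold N. rewrite <- (Nat2Z.id q). apply Z2Nat.inj_le; [lia|easy|].
    apply Z.lt_succ_r, lt_IZR. unfold Z.succ. rewrite plus_IZR, <- INR_IZR_INZ. lra. }
  (* One weight for all blocks: it dominates the bump of whichever fraction [good_block] selects. *)
  set (W := fun n : nat => rsum N (fun q => rsum (A (S q)) (fun a => weight lam sl (S q) a n))).
  assert (HW : forall n, 0 <= W n).
  { intros n. apply rsum_nonneg; intros q _. apply rsum_nonneg; intros a _.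
    apply weight_nonneg; [easy|lia]. }
  assert (HWge : forall q a n, (1 <= q)%nat -> INR q <= Q -> (a < A q)%nat ->
     weight lam sl q a n <= W n).
  { intros q a n Hq HqQ Ha. unfold W.
    destruct q as [|q]; [lia|]. apply HNQ' in HqQ.
    apply Rle_trans with (rsum (A (S q)) (fun a => weight lam sl (S q) a n)).
    - apply (rsum_term_le (A (S q)) a (fun a => weight lam sl (S q) a n)); [easy|].
      intros; apply weight_nonneg; [easy|lia].
    - apply (rsum_term_le N q (fun q => rsum (A (S q)) (fun a => weight lam sl (S q) a n))); [lia|].
      intros; apply rsum_nonneg; intros; apply weight_nonneg; [easy|lia]. }
  (* Summing over n first costs 512 / (q sqrt(lam q)) for each of at most 3 q lam m numerators. The
     sum of q^(-1/2) over q <= Q is at most 2 sqrt Q, and m sqrt(lam Q) = m/Q = k. *)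
  assert (HWsum : rsum T (fun t => W (M + t)%nat) <= 3072 * k).
  { unfold W. rewrite rsum_switch.
    apply Rle_trans with (rsum N (fun q => 1536 * (lam * m) / sqrt lam * / sqrt (INR (S q)))).
    - apply rsum_le; intros q Hq. rewrite rsum_switch.
      assert (H1 : 1 <= INR (S q)) by (change 1 with (INR 1); apply le_INR; lia).
      assert (HSQ : INR (S q) <= Q) by (apply Rle_trans with (INR N); [apply le_INR; lia|easy]).
      assert (Hlq : lam * INR (S q) <= 1).
      { apply Rle_trans with (lam * Q ^ 3); [apply Rmult_le_compat_l; [lra|]|lra].
        apply Rle_trans with (Q * 1); [lra|]. replace (Q ^ 3) with (Q * (Q * Q)) by ring.
        apply Rmult_le_compat_l; nra. }
      assert (Hs0 : 0 < sqrt lam) by (apply sqrt_lt_R0; easy).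
      assert (Hs1 : 0 < sqrt (INR (S q))) by (apply sqrt_lt_R0; lra).
      apply Rle_trans with (rsum (A (S q)) (fun _ => 512 / (INR (S q) * sqrt (lam * INR (S q))))).
      + apply rsum_le; intros a _. apply weight_sum; [easy|lia|easy|].
        intros n Hn. unfold sl.
        assert (HnM : INR n + 1 <= m) by (unfold m; rewrite <- S_INR; apply le_INR; lia).
        pose proof (slope_drop_lower (k ^ 3) m (INR (M + n) + th) 1) as H.
        rewrite !plus_INR, S_INR in *. fold m in H |- *. pose proof (pos_INR n).
        replace (m + (INR n + 1) + th) with (m + INR n + th + 1) by ring.
        unfold lam. lra.
      + rewrite rsum_const, sqrt_mult by lra.
        destruct (HA (S q)) as [_ HA2]; [lia|].
        apply Rle_trans with (3 * (INR (S q) * (lam * m)) * (512 / (INR (S q) * (sqrt lam * sqrt (INR (S q)))))).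
        * apply Rmult_le_compat_r; [|easy]. apply Rdiv_le_0_compat; [lra|].
          repeat apply Rmult_lt_0_compat; lra.
        * right. field. repeat split; lra.
    - rewrite rsum_scal. pose proof (rsum_inv_sqrt N) as HS.
      assert (Hs0 : 0 < sqrt lam) by (apply sqrt_lt_R0; easy).
      assert (Hss : sqrt lam * sqrt lam = lam) by (apply sqrt_sqrt; lra).
      assert (HsN : sqrt (INR N) <= sqrt Q) by (apply sqrt_le_1_alt; easy).
      assert (HlQs : sqrt lam * sqrt Q = / Q).
      { rewrite <- sqrt_mult by lra. replace (lam * Q) with ((/ Q) ^ 2).
        - apply sqrt_pow2. apply Rlt_le, Rinv_0_lt_compat. lra.
        - apply Rmult_eq_reg_r with (Q ^ 2); [|apply pow_nonzero; lra].
          transitivity 1; [field; lra|]. rewrite <- HlQ. ring. }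
      apply Rle_trans with (1536 * (lam * m) / sqrt lam * (2 * sqrt Q)).
      + apply Rmult_le_compat_l; [|lra]. apply Rdiv_le_0_compat; [|easy].
        lra.
      + right. replace (1536 * (lam * m) / sqrt lam) with (1536 * (sqrt lam * m))
          by (rewrite <- Hss at 2; field; lra).
        replace (1536 * (sqrt lam * m) * (2 * sqrt Q)) with (3072 * m * (sqrt lam * sqrt Q)) by ring.
        rewrite HlQs. unfold Q. field. lra. }
  pose proof (greedy_blocks (fun n => psi (k ^ 3 / (INR n + th) + c)) W 1000 (2 * k)) as G.
  eapply Rle_trans; [apply (G (fun n => psi_bound _) HW ltac:(lra) T M)|lra].
  - intros i Hi.
    assert (Him : m <= INR i) by (apply le_INR; lia).
    set (u := INR i + th).
    assert (Hu : 0 < m <= u) by (unfold u; lra).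
    destruct (good_block lam Q (fun t => k ^ 3 / (INR (i + t) + th) + c) (fun t => sl (i + t)%nat))
      as [l [q [a [Hl1 [Hl2 [Hq1 [HqQ [Hqa Hb]]]]]]]]; try easy.
    + intros t. unfold sl. rewrite !plus_INR. change (INR 0) with 0.
      pose proof (hyperbola_tangent (k ^ 3) m u (INR t) ltac:(lra) Hu (pos_INR t)) as H.
      fold lam in H. unfold u in H.
      replace (INR i + INR t + th) with (INR i + th + INR t) by ring.
      replace (INR i + 0 + th) with (INR i + th) by ring.
      replace (k ^ 3 / (INR i + th + INR t) + c - (k ^ 3 / (INR i + th) + c - k ^ 3 / (INR i + th) ^ 2 * INR t))
        with (k ^ 3 / (INR i + th + INR t) - (k ^ 3 / (INR i + th) - k ^ 3 / (INR i + th) ^ 2 * INR t)) by ring.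
      easy.
    + intros t. unfold sl. rewrite !plus_INR. change (INR 0) with 0.
      pose proof (slope_drop_upper (k ^ 3) m u (INR t) ltac:(lra) Hu (pos_INR t)) as H.
      fold lam in H. unfold u in H.
      replace (INR i + INR t + th) with (INR i + th + INR t) by ring.
      replace (INR i + 0 + th) with (INR i + th) by ring. easy.
    + exists l. split; [easy|]. split.
      (* From k <= m and m^2 <= k^3 follow m <= k^2 and m^3 <= k^5, that is, 1/lam <= k^2; so lam
         l^2 <= 4 gives l <= 2 k. *)
      * assert (INR l ^ 2 <= 4 * k ^ 2).
        { apply Rmult_le_reg_l with lam; [easy|]. eapply Rle_trans; [apply Hl2|].
          unfold lam. apply Rmult_le_reg_r with (m ^ 3); [easy|].
          replace (k ^ 3 / m ^ 3 * (4 * k ^ 2) * m ^ 3) with (4 * (k ^ 3 * k ^ 2)) by (field; lra).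
          assert (m <= k ^ 2) by (simpl in *; nra).
          replace (m ^ 3) with (m ^ 2 * m) by ring.
          apply Rmult_le_compat_l; [lra|]. apply Rmult_le_compat; try lra. apply pow2_ge_0. }
        pose proof (pos_INR l). simpl in H. nra.
      * eapply Rle_trans; [apply Hb|]. apply Rmult_le_compat_l; [lra|].
        assert (Hq' : 1 <= INR q) by (change 1 with (INR 1); apply le_INR; lia).
        assert (Hsl : 0 < sl i <= lam * m).
        { unfold sl. split; [apply Rdiv_lt_0_compat; [easy|apply pow_lt; fold u; lra]|].
          replace (lam * m) with (k ^ 3 / m ^ 2) by (unfold lam; field; lra).
          apply Rmult_le_compat_l; [lra|]. apply Rinv_le_contravar; [apply pow_lt; lra|].
          apply pow_incr. fold u. lra. }
        rewrite Nat.add_0_r in Hqa. apply Rabs_le_between in Hqa.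
        (* q times the slope is positive and within 1 of a, so a > -1. *)
        assert (Ha0 : (0 <= a)%Z).
        { apply Z.lt_succ_r, lt_IZR. unfold Z.succ. rewrite plus_IZR.
          assert (0 < INR q * sl i) by nra. lra. }
        assert (EA : IZR a = INR (Z.to_nat a)) by (rewrite INR_IZR_INZ, Z2Nat.id; easy).
        apply rsum_le; intros t _. rewrite EA. apply HWge; [easy|easy|].
        apply INR_lt. rewrite <- EA. destruct (HA q Hq1) as [HA1 _].
        assert (INR q * sl i <= INR q * (lam * m)) by (apply Rmult_le_compat_l; lra). lra.
  - lra.
Qed.

(** Each halving of the range gains 1/2 in the logarithm; times 8000000 k, this pays for one dyadic
    piece at 4000000 k. *)
Lemma ln_half_drop (x : R) : 0 < x -> ln x + / 2 <= ln (2 * x).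
Proof. intros. rewrite ln_mult by lra. pose proof ln_lt_2. lra. Qed.

(** The range is halved repeatedly, the upper half being estimated by [dyadic_bound], until at most
    2 k terms remain; these are bounded trivially. *)
Lemma psi_hyperbola_sum (k th c : R) :
  1 <= k -> 0 <= th <= 1 -> forall N : nat, INR N ^ 2 <= k ^ 3 -> 
  Rabs (rsum N (fun i => psi (k ^ 3 / (INR (S i) + th) + c)))
    <= 12000000 * k * (1 + ln k).
Proof.
  intros Hk Hth.
  assert (Hmain : forall N : nat, (1 <= N)%nat -> INR N ^ 2 <= k ^ 3 ->
    Rabs (rsum N (fun i => psi (k ^ 3 / (INR (S i) + th) + c)))
    <= 8000000 * k * (1 + ln (INR N))).
  { induction N as [N IH] using (well_founded_induction lt_wf). intros HN0 HN.
    destruct (Rle_or_lt (INR N) (2 * k)) as [Hs|Hb].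
    - eapply Rle_trans; [apply psi_rsum_trivial|].
      assert (0 <= ln (INR N)).
      { rewrite <- ln_1. apply ln_le; [lra|]. change 1 with (INR 1). apply le_INR; easy. }
      nra.
    - set (h := (N / 2)%nat).
      assert (Hh : (N = 2 * h + N mod 2 /\ N mod 2 < 2)%nat)
        by (split; [apply Nat.div_mod_eq|apply Nat.mod_upper_bound; lia]).
      assert (HN2 : (2 < N)%nat) by (apply INR_lt; simpl (INR 2); lra).
      (* The upper half starts at h + 1 and has T <= h + 1 terms, also for odd N, as [dyadic_bound]
         requires. *)
      set (T := (N - h)%nat).
      assert (HT : (T <= S h /\ N = h + T /\ 1 <= h /\ h < N)%nat) by (unfold T; lia).
      destruct HT as [HT1 [HT2 [HT3 HT4]]].
      rewrite HT2, rsum_split.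
      assert (HhN : 2 * INR h <= INR N).
      { change 2 with (INR 2). rewrite <- mult_INR. apply le_INR. lia. }
      assert (HSh : k <= INR (S h)).
      { assert (INR N <= 2 * INR (S h)); [|lra]. change 2 with (INR 2). rewrite <- mult_INR. apply le_INR. lia. }
      assert (Hp0 : 0 < INR h) by (apply lt_0_INR; lia).
      assert (I1 : INR h ^ 2 <= k ^ 3).
      { eapply Rle_trans; [|apply HN]. apply pow_incr. lra. }
      specialize (IH h HT4 HT3 I1).
      assert (I2 : INR (S h) ^ 2 <= k ^ 3).
      { eapply Rle_trans; [|apply HN]. apply pow_incr. split; [apply pos_INR|]. apply le_INR. lia. }
      pose proof (dyadic_bound k th c (S h) T Hk Hth HSh I2 HT1) as D.
      pose proof (ln_half_drop (INR h) Hp0) as L1.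
      assert (L2 : ln (2 * INR h) <= ln (INR N)) by (apply ln_le; lra).
      rewrite HT2 in L2.
      eapply Rle_trans; [apply Rabs_triang|].
      change (rsum T (fun i => psi (k ^ 3 / (INR (S (h + i)) + th) + c)))
        with (rsum T (fun t => psi (k ^ 3 / (INR (S h + t) + th) + c))).
      nra. }
  intros N HN. destruct N as [|N].
  - simpl rsum. rewrite Rabs_R0. assert (0 <= ln k) by (rewrite <- ln_1; apply ln_le; lra). nra.
  - eapply Rle_trans; [apply Hmain; [lia|easy]|].
    assert (H1 : 1 <= INR (S N)) by (change 1 with (INR 1); apply le_INR; lia).
    (* The logarithm of the length is at most (3/2) ln k, which turns 8000000 into 12000000. *)
    assert (ln (INR (S N)) * 2 <= ln k * 3).
    { assert (L : ln (INR (S N) ^ 2) <= ln (k ^ 3)) by (apply ln_le; [apply pow_lt; lra|easy]).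
      rewrite !ln_pow in L by lra. change (INR 2) with 2 in L. replace (INR 3) with 3 in L by (simpl; ring). lra. }
    nra.
Qed.

(** * Counting the n with k dividing [x/n] *)

Lemma fl_ge (t : R) (m : nat) : 0 <= t -> ((m <= fl t)%nat <-> INR m <= t).
Proof.
  intros Ht. destruct (Int_part_bounds t) as [H1 H2].
  assert (H0 : (0 <= Int_part t)%Z).
  { apply Z.lt_succ_r, lt_IZR. unfold Z.succ. rewrite plus_IZR. lra. }
  unfold fl. split; intros H.
  - apply le_INR in H. rewrite (INR_IZR_INZ (Z.to_nat _)), Z2Nat.id in H by easy. lra.
  - rewrite <- (Nat2Z.id m). apply Z2Nat.inj_le; [lia|easy|].
    apply Z.lt_succ_r, lt_IZR. unfold Z.succ. rewrite plus_IZR, <- INR_IZR_INZ. lra.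
Qed.

Lemma INR_fl (t : R) : 0 <= t -> INR (fl t) = IZR (Int_part t).
Proof.
  intros Ht. destruct (Int_part_bounds t) as [H1 H2]. unfold fl.
  rewrite INR_IZR_INZ, Z2Nat.id; [easy|].
  apply Z.lt_succ_r, lt_IZR. unfold Z.succ. rewrite plus_IZR. lra.
Qed.

Lemma INR_fl_psi (t : R) : 0 <= t -> INR (fl t) = t - 1 / 2 - psi t.
Proof. intros Ht. rewrite INR_fl by easy. unfold psi. ring. Qed.

Lemma INR_S_pos (n : nat) : 0 < INR (S n).
Proof. apply lt_0_INR; lia. Qed.

Lemma INR_pos_ge1 (n : nat) : (1 <= n)%nat -> 1 <= INR n.
Proof. intros. change 1 with (INR 1). apply le_INR; easy. Qed.

(** Both sides mean m n <= x. *)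
Lemma fl_div_swap (x : R) (m n : nat) : 0 <= x -> (1 <= m)%nat -> (1 <= n)%nat ->
  ((m <= fl (x / INR n))%nat <-> (n <= fl (x / INR m))%nat).
Proof.
  intros Hx Hm Hn. apply INR_pos_ge1 in Hm, Hn.
  rewrite !fl_ge by (apply Rdiv_le_0_compat; lra).
  split; intros H; [apply Rmult_le_reg_r with (INR m)|apply Rmult_le_reg_r with (INR n)]; try lra;
    unfold Rdiv in *; rewrite Rmult_assoc, Rinv_l by lra.
  - apply Rmult_le_compat_r with (r := INR n) in H; [|lra].
    rewrite Rmult_assoc, Rinv_l in H by lra. lra.
  - apply Rmult_le_compat_r with (r := INR m) in H; [|lra].
    rewrite Rmult_assoc, Rinv_l in H by lra. lra.
Qed.

(** Real-valued indicators turn conditions on indices into factors, so that [rsum_switch]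
    applies. *)
Definition dvd_ind (k m : nat) : R := if Nat.eqb (m mod k) 0 then 1 else 0.
Definition eqi (a b : nat) : R := if Nat.eqb a b then 1 else 0.

Lemma rsum_zero (n : nat) (F : nat -> R) : (forall i, (i < n)%nat -> F i = 0) -> rsum n F = 0.
Proof. intros H. rewrite (rsum_ext n F (fun _ => 0)) by easy. rewrite rsum_const. ring. Qed.

Lemma rsum_eqi (n p : nat) (F : nat -> R) : (p < n)%nat -> rsum n (fun i => eqi i p * F i) = F p.
Proof.
  intros H. replace n with (p + S (n - S p))%nat by lia.
  rewrite rsum_split, rsum_first, Nat.add_0_r, !rsum_zero.
  - unfold eqi. rewrite Nat.eqb_refl. ring.
  - intros i _. unfold eqi. destruct (Nat.eqb_spec (p + S i) p); [lia|ring].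
  - intros i Hi. unfold eqi. destruct (Nat.eqb_spec i p); [lia|ring].
Qed.

(** The bound on m excludes multiples of k beyond k J, and at most one of the first J can equal
    m. *)
Lemma dvd_ind_as_sum (k m J : nat) : (1 <= k)%nat -> (1 <= m)%nat -> (m < k * S J)%nat ->
  rsum J (fun j => eqi m (k * S j)) = dvd_ind k m.
Proof.
  intros Hk Hm HJ. unfold dvd_ind.
  pose proof (Nat.div_mod_eq m k) as D.
  destruct (Nat.eqb_spec (m mod k) 0) as [E|E].
  - assert (1 <= m / k)%nat by nia. assert (m / k <= J)%nat by nia.
    rewrite <- (rsum_eqi J (m / k - 1) (fun _ => 1)) by lia.
    apply rsum_ext; intros j Hj. unfold eqi.
    destruct (Nat.eqb_spec m (k * S j)), (Nat.eqb_spec j (m / k - 1)); try ring; exfalso; nia.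
  - apply rsum_zero; intros j _. unfold eqi.
    destruct (Nat.eqb_spec m (k * S j)) as [E'|]; [|easy].
    exfalso. apply E. rewrite E', Nat.mul_comm. apply Nat.Div0.mod_mul.
Qed.

Lemma rsum_eqi_large (k m J : nat) : (k * S J <= m)%nat -> (1 <= k)%nat ->
  rsum J (fun j => eqi m (k * S j)) = 0.
Proof.
  intros H Hk. apply rsum_zero; intros j Hj. unfold eqi.
  destruct (Nat.eqb_spec m (k * S j)); [nia|easy].
Qed.

Lemma rsum_multiples (k X : nat) (F : nat -> R) : (1 <= k)%nat ->
  rsum X (fun m => dvd_ind k (S m) * F (S m)) = rsum (X / k) (fun j => F (k * S j)%nat).
Proof.
  intros Hk. pose proof (Nat.div_mod_eq X k). pose proof (Nat.mod_upper_bound X k ltac:(lia)).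
  rewrite (rsum_ext X _ (fun m => rsum (X / k) (fun j => eqi (S m) (k * S j) * F (S m)))).
  - rewrite rsum_switch. apply rsum_ext; intros j Hj.
    rewrite (rsum_ext X _ (fun m => eqi m (k * S j - 1) * F (S m))).
    + rewrite rsum_eqi by nia. f_equal. nia.
    + intros m _. unfold eqi.
      destruct (Nat.eqb_spec (S m) (k * S j)), (Nat.eqb_spec m (k * S j - 1)); try ring; exfalso; nia.
  - intros m Hm. rewrite <- (dvd_ind_as_sum k (S m) (X / k)) by nia.
    rewrite Rmult_comm, <- rsum_scal. apply rsum_ext; intros; ring.
Qed.

(** The indicator equals [t/k] - [(t - 1)/k]: with [t] = k q + r, the first floor is q and the
    second is q - 1 or q according as r is 0 or not. *)
Lemma dvd_ind_floor (k : nat) (t : R) : (1 <= k)%nat -> 0 <= t ->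
  dvd_ind k (fl t) = / INR k - psi (t / INR k) + psi (t / INR k - / INR k).
Proof.
  intros Hk Ht. assert (Hk' : 1 <= INR k) by (apply INR_pos_ge1; easy).
  pose proof (INR_fl t Ht) as E. destruct (Int_part_bounds t) as [B1 B2]. rewrite <- E in B1, B2.
  set (m := fl t) in *. pose proof (Nat.div_mod_eq m k) as D.
  pose proof (Nat.mod_upper_bound m k ltac:(lia)) as Hr.
  set (q := (m / k)%nat) in *. set (r := (m mod k)%nat) in *.
  assert (Hm : INR m = INR k * INR q + INR r) by (rewrite D at 1; rewrite plus_INR, mult_INR; easy).
  assert (Hr' : INR r + 1 <= INR k) by (rewrite <- S_INR; apply le_INR; lia).
  pose proof (pos_INR r) as Hr0.
  assert (F1 : Int_part (t / INR k) = Z.of_nat q).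
  { apply Int_part_unique. rewrite <- INR_IZR_INZ. split.
    - apply Rmult_le_reg_r with (INR k); [lra|]. unfold Rdiv. rewrite Rmult_assoc, Rinv_l by lra. lra.
    - apply Rmult_lt_reg_r with (INR k); [lra|]. unfold Rdiv. rewrite Rmult_assoc, Rinv_l by lra. lra. }
  assert (Eq : t / INR k - / INR k = (t - 1) / INR k) by (field; lra).
  unfold psi. rewrite F1, Eq. unfold dvd_ind. fold r.
  destruct (Nat.eqb_spec r 0) as [Z0|Z0].
  - rewrite (Int_part_unique ((t - 1) / INR k) (Z.of_nat q - 1)).
    + rewrite minus_IZR. field. lra.
    + rewrite minus_IZR, <- INR_IZR_INZ. rewrite Z0 in *. simpl (INR 0) in *. split.
      * apply Rmult_le_reg_r with (INR k); [lra|]. unfold Rdiv. rewrite Rmult_assoc, Rinv_l by lra. lra.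
      * apply Rmult_lt_reg_r with (INR k); [lra|]. unfold Rdiv. rewrite Rmult_assoc, Rinv_l by lra. lra.
  - assert (1 <= INR r) by (apply INR_pos_ge1; lia).
    rewrite (Int_part_unique ((t - 1) / INR k) (Z.of_nat q)).
    + field. lra.
    + rewrite <- INR_IZR_INZ. split.
      * apply Rmult_le_reg_r with (INR k); [lra|]. unfold Rdiv. rewrite Rmult_assoc, Rinv_l by lra. lra.
      * apply Rmult_lt_reg_r with (INR k); [lra|]. unfold Rdiv. rewrite Rmult_assoc, Rinv_l by lra. lra.
Qed.

Lemma rsum_leb (X p : nat) : (p <= X)%nat ->
  rsum X (fun n => if Nat.leb (S n) p then 1 else 0) = INR p.
Proof.
  intros H. replace X with (p + (X - p))%nat by lia. rewrite rsum_split.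
  rewrite (rsum_ext p _ (fun _ => 1)), rsum_const, rsum_zero.
  - ring.
  - intros i _. destruct (Nat.leb_spec (S (p + i)) p); [lia|easy].
  - intros i Hi. destruct (Nat.leb_spec (S i) p); [easy|lia].
Qed.

Lemma Rdiv_le_self (x d : R) : 0 <= x -> 1 <= d -> x / d <= x.
Proof.
  intros Hx Hd. apply Rmult_le_reg_r with d; [lra|].
  unfold Rdiv. rewrite Rmult_assoc, Rinv_l by lra. nra.
Qed.

Lemma fl_div_le (x : R) (m : nat) : 0 <= x -> (1 <= m)%nat -> (fl (x / INR m) <= fl x)%nat.
Proof.
  intros Hx Hm. apply INR_pos_ge1 in Hm. apply fl_ge; [easy|].
  assert (H : 0 <= x / INR m) by (apply Rdiv_le_0_compat; lra).
  apply Rle_trans with (x / INR m); [apply fl_ge; [easy|lia]|apply Rdiv_le_self; lra].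
Qed.

(** [x/n] = m means x/(m + 1) < n <= x/m. *)
Lemma fl_fiber_count (x : R) (m : nat) : 0 <= x -> (1 <= m)%nat ->
  rsum (fl x) (fun n => eqi (fl (x / INR (S n))) m) = INR (fl (x / INR m)) - INR (fl (x / INR (S m))).
Proof.
  intros Hx Hm.
  rewrite <- (rsum_leb (fl x) (fl (x / INR m))) by (apply fl_div_le; easy).
  rewrite <- (rsum_leb (fl x) (fl (x / INR (S m)))) by (apply fl_div_le; [easy|lia]).
  rewrite <- rsum_minus. apply rsum_ext; intros n _. unfold eqi.
  pose proof (fl_div_swap x m (S n) Hx Hm ltac:(lia)).
  pose proof (fl_div_swap x (S m) (S n) Hx ltac:(lia) ltac:(lia)).
  destruct (Nat.eqb_spec (fl (x / INR (S n))) m), (Nat.leb_spec (S n) (fl (x / INR m))),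
    (Nat.leb_spec (S n) (fl (x / INR (S m)))); try ring; exfalso; lia.
Qed.

(* Hyperbola method: the second sum runs over the n with [x/n] >= k (J+1). *)
Lemma multiples_hyperbola (x : R) (k J : nat) : 0 <= x -> (1 <= k)%nat ->
  rsum (fl x) (fun n => dvd_ind k (fl (x / INR (S n)))) =
  rsum J (fun j => INR (fl (x / INR (k * S j))) - INR (fl (x / INR (S (k * S j)))))
  + rsum (fl (x / INR (k * S J))) (fun n => dvd_ind k (fl (x / INR (S n)))).
Proof.
  intros Hx Hk. set (N := fl (x / INR (k * S J))).
  rewrite (rsum_ext J _ (fun j => rsum (fl x) (fun n => eqi (fl (x / INR (S n))) (k * S j))))
    by (intros j _; rewrite fl_fiber_count by (easy || nia); easy).
  rewrite rsum_switch.
  assert (HN : (N <= fl x)%nat) by (apply fl_div_le; [easy|nia]).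
  replace (fl x) with (N + (fl x - N))%nat at 1 2 by lia. rewrite !rsum_split.
  (* For n <= N the quotient [x/n] is at least k (J + 1), so it is none of the first J multiples;
     for n > N it is smaller, and [dvd_ind_as_sum] applies. *)
  rewrite (rsum_zero N (fun i => rsum J _)).
  - rewrite Rplus_comm. f_equal. rewrite Rplus_0_l.
    apply rsum_ext; intros i Hi. rewrite dvd_ind_as_sum; [easy|easy| |].
    + apply fl_div_swap; [easy|lia|lia|]. replace (x / INR 1) with x by (simpl; field). lia.
    + pose proof (fl_div_swap x (k * S J) (S (N + i)) Hx ltac:(nia) ltac:(lia)). lia.
  - intros i Hi. apply rsum_eqi_large; [|easy].
    apply fl_div_swap; [easy|nia|lia|]. fold N. lia.
Qed.

(** With s = J + i + 1, the terms lie between 1/(s (s + 1)) and 1/((s - 1) s), which both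
    telescope. *)
Lemma tail_sum_bounds (d : R) (J n : nat) : 0 <= d <= 1 -> (1 <= J)%nat ->
  / INR (S J) - / INR (S (J + n)) <= rsum n (fun i => / (INR (S (J + i)) * (INR (S (J + i)) + d)))
    <= / INR J.
Proof.
  intros Hd HJ. apply INR_pos_ge1 in HJ. split.
  - pose proof (rsum_telescope n (fun i => / INR (S (J + i)))) as T. cbv beta in T.
    rewrite Nat.add_0_r in T. rewrite <- T.
    apply rsum_le; intros i _. rewrite Nat.add_succ_r. rewrite (S_INR (S (J + i))).
    pose proof (INR_S_pos (J + i)). set (s := INR (S (J + i))) in *.
    replace (/ s - / (s + 1)) with (/ (s * (s + 1))) by (field; lra).
    apply Rinv_le_contravar; nra.
  - pose proof (rsum_telescope n (fun i => / INR (J + i))) as T. cbv beta in T.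
    rewrite Nat.add_0_r in T.
    assert (0 < INR (J + n)) by (rewrite plus_INR; pose proof (pos_INR n); lra).
    assert (0 < / INR (J + n)) by (apply Rinv_0_lt_compat; easy).
    apply Rle_trans with (/ INR J - / INR (J + n)); [|lra]. rewrite <- T.
    apply rsum_le; intros i _. rewrite Nat.add_succ_r, S_INR.
    assert (0 < INR (J + i)) by (rewrite plus_INR; pose proof (pos_INR i); lra).
    set (s := INR (J + i)) in *.
    replace (/ s - / (s + 1)) with (/ (s * (s + 1))) by (field; lra).
    apply Rinv_le_contravar; nra.
Qed.

(** The hyperbola is split at J = [sqrt y]. The main terms agree up to 3, and four sawtooth sums at
    12000000 each stay within 50000000. *)
Lemma multiples_error (x kap : R) (k : nat) :
  (1 <= k)%nat -> 1 <= kap -> kap ^ 3 = x / INR k ->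
  Rabs (rsum (fl x) (fun n => dvd_ind k (fl (x / INR (S n))))
        - x * rsum (fl x) (fun m => dvd_ind k (S m) * / (INR (S m) * INR (S (S m)))))
    <= 50000000 * kap * (1 + ln kap).
Proof.
  intros Hk Hkap Hcube. assert (Hk1 : 1 <= INR k) by (apply INR_pos_ge1; easy).
  set (y := x / INR k) in *.
  assert (Hy1 : 1 <= y).
  { rewrite <- Hcube. apply Rle_trans with (1 ^ 3); [simpl; lra|apply pow_incr; lra]. }
  assert (Hxy : x = y * INR k) by (unfold y; field; lra).
  assert (Hx : 0 <= x) by nra.
  set (J := fl (sqrt y)).
  assert (Hsq : sqrt y * sqrt y = y) by (apply sqrt_sqrt; lra).
  assert (Hsq1 : 1 <= sqrt y) by (rewrite <- sqrt_1; apply sqrt_le_1_alt; easy).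
  assert (HJ1 : INR J <= sqrt y) by (apply fl_ge; [lra|unfold J; lia]).
  assert (HJ2 : sqrt y < INR (S J)).
  { apply Rnot_le_lt. intros H. apply fl_ge in H; [|lra]. unfold J in H. lia. }
  assert (HJ0 : (1 <= J)%nat) by (apply fl_ge; simpl; lra).
  assert (HJ0' : 1 <= INR J) by (apply INR_pos_ge1; easy).
  rewrite (multiples_hyperbola x k J) by easy.
  set (N := fl (x / INR (k * S J))).
  assert (HkJ : x / INR (k * S J) = y / INR (S J)).
  { rewrite mult_INR. unfold y. field. lra. }
  assert (HyJ : 0 <= y / INR (S J)) by (apply Rdiv_le_0_compat; lra).
  assert (HN1 : INR N <= y / INR (S J)) by (unfold N; rewrite HkJ; apply fl_ge; [easy|lia]).
  assert (HN2 : y / INR (S J) < INR N + 1).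
  { rewrite <- S_INR. apply Rnot_le_lt. intros H. apply fl_ge in H; [|easy].
    unfold N in H. rewrite HkJ in H. lia. }
  assert (HNsq : INR N ^ 2 <= kap ^ 3).
  { rewrite Hcube. apply Rle_trans with (sqrt y ^ 2); [|simpl; lra]. apply pow_incr.
    split; [apply pos_INR|]. apply Rle_trans with (y / INR (S J)); [easy|].
    apply Rmult_le_reg_r with (INR (S J)); [lra|]. unfold Rdiv. rewrite Rmult_assoc, Rinv_l by lra. nra. }
  assert (HJsq : INR J ^ 2 <= kap ^ 3).
  { rewrite Hcube. apply Rle_trans with (sqrt y ^ 2); [|simpl; lra]. apply pow_incr. lra. }
  assert (Hik : 0 < / INR k <= 1).
  { split; [apply Rinv_0_lt_compat; lra|]. rewrite <- Rinv_1. apply Rinv_le_contravar; lra. }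
  (* x/(k j) = y/j and x/(k j + 1) = y/(j + 1/k) lead to the first two sums; the last two, with
     shift - 1/k, come from [dvd_ind_floor]. *)
  pose proof (psi_hyperbola_sum kap 0 0 Hkap ltac:(lra) J HJsq) as P1.
  pose proof (psi_hyperbola_sum kap (/ INR k) 0 Hkap ltac:(lra) J HJsq) as P2.
  pose proof (psi_hyperbola_sum kap 0 0 Hkap ltac:(lra) N HNsq) as P3.
  pose proof (psi_hyperbola_sum kap 0 (- / INR k) Hkap ltac:(lra) N HNsq) as P4.
  rewrite Hcube in P1, P2, P3, P4.
  set (s1 := rsum J (fun i => psi (y / (INR (S i) + 0) + 0))) in *.
  set (s2 := rsum J (fun i => psi (y / (INR (S i) + / INR k) + 0))) in *.
  set (s3 := rsum N (fun i => psi (y / (INR (S i) + 0) + 0))) in *.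
  set (s4 := rsum N (fun i => psi (y / (INR (S i) + 0) + - / INR k))) in *.
  (* At m = k j, both x/m - x/(m + 1) and x/(m (m + 1)) equal y/k times this quantity; the index is
     shifted by one. *)
  set (tau := fun j : nat => / (INR (S j) * (INR (S j) + / INR k))).
  assert (E1 : rsum J (fun j => INR (fl (x / INR (k * S j))) - INR (fl (x / INR (S (k * S j)))))
               = y / INR k * rsum J tau - s1 + s2).
  { unfold s1, s2. rewrite <- rsum_scal, <- rsum_minus, <- rsum_plus.
    apply rsum_ext; intros j _. pose proof (INR_S_pos j).
    replace (x / INR (k * S j)) with (y / (INR (S j) + 0) + 0)
      by (rewrite mult_INR; unfold y; field; lra).
    replace (x / INR (S (k * S j))) with (y / (INR (S j) + / INR k) + 0).
    2: { rewrite (S_INR (k * S j)), mult_INR. unfold y. field. repeat split; try lra; nra. }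
    rewrite !INR_fl_psi by (rewrite Rplus_0_r; apply Rdiv_le_0_compat; lra).
    unfold tau. 
    assert (y / (INR (S j) + 0) - y / (INR (S j) + / INR k) = y / INR k * / (INR (S j) * (INR (S j) + / INR k))); [|lra].
    field. repeat split; try lra; nra. }
  assert (E2 : rsum N (fun n => dvd_ind k (fl (x / INR (S n)))) = INR N / INR k - s3 + s4).
  { unfold s3, s4. replace (INR N / INR k) with (rsum N (fun _ => / INR k)) by apply rsum_const.
    rewrite <- rsum_minus, <- rsum_plus.
    apply rsum_ext; intros n _. pose proof (INR_S_pos n).
    rewrite dvd_ind_floor; [|easy|apply Rdiv_le_0_compat; lra].
    replace (x / INR (S n) / INR k) with (y / (INR (S n) + 0) + 0) by (unfold y; field; lra).
    replace (y / (INR (S n) + 0) + - / INR k) with (y / (INR (S n) + 0) + 0 - / INR k) by ring.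
    easy. }
  set (J' := (fl x / k)%nat).
  pose proof (Nat.div_mod_eq (fl x) k) as Dv. pose proof (Nat.mod_upper_bound (fl x) k ltac:(lia)) as Db.
  fold J' in Dv.
  assert (HJJ' : (J <= J')%nat).
  { assert (k * J <= fl x)%nat; [|nia]. apply fl_ge; [easy|]. rewrite mult_INR, Hxy.
    rewrite Rmult_comm. apply Rmult_le_compat_r; nra. }
  assert (HyJ' : y < INR (S J')).
  { apply Rmult_lt_reg_r with (INR k); [lra|]. rewrite <- Hxy, <- mult_INR.
    apply Rnot_le_lt. intros H. apply fl_ge in H; [|easy]. nia. }
  assert (E3 : x * rsum (fl x) (fun m => dvd_ind k (S m) * / (INR (S m) * INR (S (S m))))
    = y / INR k * rsum J tau + y / INR k * rsum (J' - J) (fun i => tau (J + i)%nat)).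
  { rewrite (rsum_multiples k (fl x) (fun m => / (INR m * INR (S m)))) by easy.
    fold J'. rewrite <- Rmult_plus_distr_l, <- rsum_split.
    replace (J + (J' - J))%nat with J' by lia. rewrite <- !rsum_scal.
    apply rsum_ext; intros j _. pose proof (INR_S_pos j). unfold tau.
    rewrite (S_INR (k * S j)), mult_INR, Hxy. field. repeat split; try lra; nra. }
  rewrite E1, E2, E3.
  pose proof (tail_sum_bounds (/ INR k) J (J' - J) ltac:(lra) HJ0) as [T1 T2].
  replace (J + (J' - J))%nat with J' in T1 by lia.
  set (tl := rsum (J' - J) (fun i => tau (J + i)%nat)).
  change (rsum (J' - J) (fun i => / (INR (S (J + i)) * (INR (S (J + i)) + / INR k)))) with tl in T1, T2.
  (* Both N and y times the tail are near y/(J + 1): the floor costs 1, truncation at J' costs at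
     most 1, and y/J - y/(J + 1) is at most 2 because y < (J + 1)^2. *)
  assert (Hmid : Rabs (INR N / INR k - y / INR k * tl) <= 3).
  { replace (INR N / INR k - y / INR k * tl) with ((INR N - y * tl) * / INR k) by (field; lra).
    rewrite Rabs_mult, (Rabs_right (/ INR k)) by lra.
    assert (Rabs (INR N - y * tl) <= 3).
    { apply Rmult_le_compat_l with (r := y) in T1, T2; try lra.
      assert (y * / INR (S J') <= 1).
      { apply Rmult_le_reg_r with (INR (S J')); [lra|]. rewrite Rmult_assoc, Rinv_l; lra. }
      assert (y * / INR J - y / INR (S J) <= 2).
      { replace (y * / INR J - y / INR (S J)) with (y / (INR J * INR (S J)))
          by (rewrite S_INR; field; lra).
        apply Rmult_le_reg_r with (INR J * INR (S J)); [nra|].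
        unfold Rdiv. rewrite Rmult_assoc, Rinv_l by nra. rewrite S_INR in *. nra. }
      unfold Rdiv in *. apply Rabs_le. lra. }
    pose proof (Rabs_pos (INR N - y * tl)). nra. }
  assert (Hln : 0 <= ln kap) by (rewrite <- ln_1; apply ln_le; lra).
  assert (1 <= kap * (1 + ln kap)) by nra.
  apply Rabs_le_between in P1, P2, P3, P4, Hmid. apply Rabs_le. lra.
Qed.

(** * Real-valued g *)

Definition harmonic (n : nat) : R := rsum n (fun i => / INR (S i)).

(** The induction step is 1 - u <= exp(-u) at u = 1/(n + 2). *)
Lemma harmonic_le_ln (n : nat) : harmonic (S n) <= 1 + ln (INR (S n)).
Proof.
  induction n as [|n IH].
  - unfold harmonic. simpl. rewrite ln_1. lra.
  - change (harmonic (S n) + / INR (S (S n)) <= 1 + ln (INR (S (S n)))).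
    pose proof (INR_S_pos n). pose proof (INR_S_pos (S n)).
    assert (ln (INR (S n)) <= ln (INR (S (S n))) - / INR (S (S n))); [|lra].
    assert (E : INR (S n) <= INR (S (S n)) * exp (- / INR (S (S n)))).
    { pose proof (exp_ineq1_le (- / INR (S (S n)))) as X.
      apply Rmult_le_compat_l with (r := INR (S (S n))) in X; [|lra].
      rewrite Rmult_plus_distr_l, <- Ropp_mult_distr_r, Rinv_r in X by lra.
      rewrite (S_INR (S n)) in X at 1. lra. }
    apply ln_le in E; [|easy]. rewrite ln_mult, ln_exp in E by (easy || apply exp_pos). lra.
Qed.

(** * Cube roots and the sum of k^(-4/3) *)

Definition cbrt (t : R) : R := Rpower t (1 / 3).

Lemma cbrt_pos (t : R) : 0 < cbrt t.
Proof. apply exp_pos. Qed.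

Lemma cbrt_pow3 (t : R) : 0 < t -> cbrt t ^ 3 = t.
Proof.
  intros H. unfold cbrt. rewrite <- Rpower_pow by apply exp_pos. rewrite Rpower_mult.
  replace (1 / 3 * INR 3) with 1 by (simpl; field). apply Rpower_1; easy.
Qed.

Lemma cbrt_ge1 (t : R) : 1 <= t -> 1 <= cbrt t.
Proof.
  intros H. apply Rnot_lt_le. intros C. pose proof (cbrt_pos t). 
  pose proof (cbrt_pow3 t ltac:(lra)) as E.
  assert (cbrt t * cbrt t < 1) by nra. simpl in E. nra.
Qed.

Lemma ln_cbrt (t : R) : ln (cbrt t) = ln t / 3.
Proof. unfold cbrt, Rpower. rewrite ln_exp. field. Qed.

Lemma cbrt_mult (s t : R) : 0 < s -> 0 < t -> cbrt (s * t) = cbrt s * cbrt t.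
Proof. intros. unfold cbrt. symmetry. apply Rpower_mult_distr; easy. Qed.

(* 1/u - 1/v = 1/(uv(u^2+uv+v^2)) when v^3 = u^3 + 1, which makes the sum telescope. *)
Lemma sum_four_thirds (n : nat) :
  rsum n (fun i => / (INR (S i) * cbrt (INR (S i)))) <= 4.
Proof.
  (* The subtracted term makes the bound inductive: its change is 3 (1/u - 1/v), at least the new
     term 1/v^4 since u < v. *)
  assert (H : rsum (S n) (fun i => / (INR (S i) * cbrt (INR (S i)))) <= 4 - 3 * / cbrt (INR (S n))).
  { induction n as [|n IH].
    - assert (E : Rpower 1 (1 / 3) = 1) by (unfold Rpower; rewrite ln_1, Rmult_0_r; apply exp_0).
      simpl. unfold cbrt. rewrite E. lra.
    - change (rsum (S n) (fun i => / (INR (S i) * cbrt (INR (S i)))) + / (INR (S (S n)) * cbrt (INR (S (S n))))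
        <= 4 - 3 * / cbrt (INR (S (S n)))).
      pose proof (INR_S_pos n) as P1. pose proof (INR_S_pos (S n)) as P2.
      pose proof (cbrt_pos (INR (S n))) as U. pose proof (cbrt_pos (INR (S (S n)))) as V.
      pose proof (cbrt_pow3 _ P1) as U3. pose proof (cbrt_pow3 _ P2) as V3.
      rewrite (S_INR (S n)) in V3 at 2.
      set (u := cbrt (INR (S n))) in *. set (v := cbrt (INR (S (S n)))) in *.
      rewrite S_INR, <- V3 by easy. rewrite <- U3 in V3.
      assert (u < v).
      { apply Rnot_le_lt. intros C. assert (v ^ 3 <= u ^ 3) by (apply pow_incr; lra). lra. }
      assert (/ u - / v = / (u * v * (u ^ 2 + u * v + v ^ 2))).
      { assert (0 < u * v * (u ^ 2 + u * v + v ^ 2)) by (repeat apply Rmult_lt_0_compat; nra).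
        apply Rmult_eq_reg_r with (u * v * (u ^ 2 + u * v + v ^ 2)); [|lra].
        rewrite Rinv_l by lra. transitivity (v ^ 3 - u ^ 3); [field; lra|lra]. }
      assert (/ (v ^ 3 * v) <= 3 * / (u * v * (u ^ 2 + u * v + v ^ 2))).
      { replace (/ (v ^ 3 * v)) with (3 * / (v * v * (3 * v ^ 2))) by (field; lra).
        apply Rmult_le_compat_l; [lra|]. apply Rinv_le_contravar.
        - repeat apply Rmult_lt_0_compat; nra.
        - apply Rmult_le_compat; nra. }
      lra. }
  eapply Rle_trans; [|eapply Rle_trans; [apply H|]].
  - pose proof (INR_S_pos n). pose proof (cbrt_pos (INR (S n))).
    assert (0 < / (INR (S n) * cbrt (INR (S n)))) by (apply Rinv_0_lt_compat; nra).
    set (F := fun i => / (INR (S i) * cbrt (INR (S i)))).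
    change (rsum n F <= rsum n F + / (INR (S n) * cbrt (INR (S n)))). lra.
  - pose proof (cbrt_pos (INR (S n))) as P. apply Rinv_0_lt_compat in P. lra.
Qed.

(** * Series with a telescoping majorant *)

Lemma sum_n_rsum (a : nat -> R) (n : nat) : sum_n a n = rsum (S n) a.
Proof.
  induction n as [|n IH]; [rewrite sum_O; simpl; ring|].
  rewrite sum_Sn, IH. easy.
Qed.

(** U decreases and is nonnegative, so it converges and its drops are summable; from n on they add
    up to at most U n. *)
Lemma series_telescoping_majorant (a U : nat -> R) :
  (forall k, 0 <= U k) -> (forall k, Rabs (a k) <= U k - U (S k)) ->
  exists L : R, is_series a L /\ forall n, Rabs (L - rsum n a) <= U n.
Proof.
  intros HU Ha.
  assert (EU : ex_series (fun k => U k - U (S k))).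
  { assert (Ex : ex_finite_lim_seq U).
    { apply ex_finite_lim_seq_decr with 0; [|easy].
      intros n. pose proof (Rabs_pos (a n)). specialize (Ha n). lra. }
    destruct Ex as [l Hl]. exists (U O - l).
    change (is_lim_seq (sum_n (fun k => U k - U (S k))) (Finite (U O - l))).
    apply is_lim_seq_ext with (fun n => U O - U (S n)).
    - intros n. rewrite sum_n_rsum, rsum_telescope. easy.
    - apply is_lim_seq_minus'; [apply is_lim_seq_const|apply (is_lim_seq_incr_1 U); easy]. }
  assert (Ea : ex_series a) by (apply (ex_series_le a (fun k => U k - U (S k))); [exact Ha|exact EU]).
  destruct Ea as [L HL]. exists L. split; [easy|]. intros n.
  assert (HP : is_lim_seq (fun N => rsum (S N) a) L).
  { apply is_lim_seq_ext with (sum_n a); [intros; apply sum_n_rsum|exact HL]. }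
  apply (is_lim_seq_incr_1 (fun N => rsum N a)) in HP.
  apply (is_lim_seq_incr_n _ n) in HP.
  assert (HD : is_lim_seq (fun N => Rabs (rsum (N + n) a - rsum n a)) (Rabs (L - rsum n a))).
  { apply (is_lim_seq_abs _ (Finite (L - rsum n a))). apply is_lim_seq_minus'; [easy|apply is_lim_seq_const]. }
  apply (is_lim_seq_le _ (fun _ => U n) (Rabs (L - rsum n a)) (U n)) in HD; [easy| |apply is_lim_seq_const].
  intros N. rewrite Nat.add_comm, rsum_split.
  replace (rsum n a + rsum N (fun i => a (n + i)%nat) - rsum n a) with (rsum N (fun i => a (n + i)%nat)) by ring.
  eapply Rle_trans; [apply rsum_abs|].
  apply Rle_trans with (rsum N (fun i => U (n + i)%nat - U (n + S i)%nat)).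
  - apply rsum_le; intros i _. rewrite Nat.add_succ_r. apply Ha.
  - rewrite (rsum_telescope N (fun i => U (n + i)%nat)), Nat.add_0_r. specialize (HU (n + N)%nat). lra.
Qed.

(** * The convolution and its asymptotics over the reals *)

Definition real_id_conv (g : nat -> R) (n : nat) : R :=
  rsum n (fun d => dvd_ind (S d) n * (INR (S d) * g (n / S d)%nat)).

(** Both sides run over factorizations m = d k, and d/m = 1/k. Terms with k > m vanish, so one range
    M serves all the values [x/n] at once. *)
Lemma real_id_conv_quotient (g : nat -> R) (m M : nat) : (1 <= m)%nat -> (m <= M)%nat ->
  real_id_conv g m / INR m = rsum M (fun k => dvd_ind (S k) m * (g (S k) / INR (S k))).
Proof.
  intros Hm HM. assert (Hm' : 1 <= INR m) by (apply INR_pos_ge1; easy).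
  replace M with (m + (M - m))%nat by lia. rewrite rsum_split, (rsum_zero (M - m)).
  2: { intros k _. unfold dvd_ind. rewrite Nat.mod_small by lia.
       destruct (Nat.eqb_spec m 0); [lia|ring]. }
  rewrite Rplus_0_r. unfold Rdiv at 1. rewrite Rmult_comm. unfold real_id_conv.
  rewrite <- rsum_scal.
  rewrite (rsum_ext m _ (fun d => rsum m (fun k => eqi m (S d * S k) * (g (S k) / INR (S k))))).
  - rewrite rsum_switch. apply rsum_ext; intros k Hk.
    rewrite <- (dvd_ind_as_sum (S k) m m) by nia. rewrite Rmult_comm, <- rsum_scal.
    apply rsum_ext; intros d _. rewrite Nat.mul_comm. ring.
  - intros d Hd. rewrite <- (dvd_ind_as_sum (S d) m m) by nia.
    rewrite <- Rmult_assoc, (Rmult_comm (/ INR m)), Rmult_assoc, Rmult_comm, <- rsum_scal.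
    apply rsum_ext; intros k _. unfold eqi. destruct (Nat.eqb_spec m (S d * S k)) as [E|E]; [|ring].
    replace (m / S d)%nat with (S k) by (rewrite E, Nat.mul_comm, Nat.div_mul; lia).
    rewrite E, mult_INR. pose proof (INR_S_pos d). pose proof (INR_S_pos k). field. lra.
Qed.

Lemma real_id_conv_bound (g : nat -> R) (B : R) (m : nat) :
  (forall n, (1 <= n)%nat -> Rabs (g n) <= B) -> (1 <= m)%nat ->
  Rabs (real_id_conv g m / INR m) <= B * harmonic m.
Proof.
  intros Hg Hm. rewrite (real_id_conv_quotient g m m) by lia.
  eapply Rle_trans; [apply rsum_abs|]. unfold harmonic. rewrite <- rsum_scal.
  apply rsum_le; intros k _. pose proof (INR_S_pos k).
  rewrite Rabs_mult, Rabs_div, (Rabs_right (INR (S k))) by lra.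
  assert (0 <= Rabs (dvd_ind (S k) m) <= 1)
    by (unfold dvd_ind; destruct (Nat.eqb _ _); rewrite ?Rabs_R0, ?Rabs_R1; lra).
  specialize (Hg (S k) ltac:(lia)). pose proof (Rabs_pos (g (S k))).
  assert (0 < / INR (S k)) by (apply Rinv_0_lt_compat; lra).
  apply Rle_trans with (1 * (B * / INR (S k))); [|lra].
  apply Rmult_le_compat; [lra|apply Rmult_le_pos; lra|lra|apply Rmult_le_compat_r; lra].
Qed.

Definition real_series_term (f : nat -> R) (k : nat) : R :=
  f (S k) / (INR (S k) ^ 2 * INR (S (S k))).

Definition real_Ssum (f : nat -> R) (x : R) : R :=
  rsum (fl x) (fun n => f (fl (x / INR (S n))) / INR (fl (x / INR (S n)))).

(** The terms are at most B H(s)/(s (s + 1)), with s = k + 1 and H the harmonic number. The added 1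
    in the majorant pays for the growth of H: its drop exceeds this bound by B/(s (s + 1)^2). *)
Lemma real_series_tail (g : nat -> R) (B : R) :
  (forall n, (1 <= n)%nat -> Rabs (g n) <= B) ->
  exists L : R, is_series (real_series_term (real_id_conv g)) L /\
    forall n, Rabs (L - rsum n (real_series_term (real_id_conv g)))
                <= B * ((harmonic (S n) + 1) / INR (S n)).
Proof.
  intros Hg.
  assert (HB : 0 <= B) by (apply Rle_trans with (Rabs (g 1%nat)); [apply Rabs_pos|apply Hg; lia]).
  assert (Hh : forall n, 0 <= harmonic n).
  { intros n. apply rsum_nonneg; intros. apply Rlt_le, Rinv_0_lt_compat, INR_S_pos. }
  apply (series_telescoping_majorant _ (fun n => B * ((harmonic (S n) + 1) / INR (S n)))).
  - intros k. apply Rmult_le_pos; [easy|]. apply Rdiv_le_0_compat; [specialize (Hh (S k)); lra|apply INR_S_pos].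
  - intros k. pose proof (INR_S_pos k) as P. pose proof (INR_S_pos (S k)) as P'.
    pose proof (real_id_conv_bound g B (S k) Hg ltac:(lia)) as H.
    unfold real_series_term.
    replace (real_id_conv g (S k) / (INR (S k) ^ 2 * INR (S (S k))))
      with (real_id_conv g (S k) / INR (S k) * / (INR (S k) * INR (S (S k)))) by (field; lra).
    assert (Q : 0 < / (INR (S k) * INR (S (S k)))) by (apply Rinv_0_lt_compat; nra).
    rewrite Rabs_mult, (Rabs_right (/ _)) by lra.
    apply Rle_trans with (B * harmonic (S k) * / (INR (S k) * INR (S (S k)))); [apply Rmult_le_compat_r; lra|].
    rewrite <- Rmult_minus_distr_l, Rmult_assoc. apply Rmult_le_compat_l; [easy|].
    change (harmonic (S (S k))) with (harmonic (S k) + / INR (S (S k))).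
    specialize (Hh (S k)). set (h := harmonic (S k)) in *.
    rewrite (S_INR (S k)) in *. set (s := INR (S k)) in *.
    assert ((h + 1) / s - (h + / (s + 1) + 1) / (s + 1) - h * / (s * (s + 1)) = / (s * (s + 1) ^ 2))
      by (field; lra).
    assert (0 < / (s * (s + 1) ^ 2)) by (apply Rinv_0_lt_compat; nra). lra.
Qed.

(** After interchanging sums, the error at k is O((x/k)^(1/3) ln x) with weight g(k)/k; since
    k^(-4/3) sums to at most 4, no further logarithm arises. The tail of the series accounts for the
    remaining 10. *)
Lemma real_Ssum_asymptotics (g : nat -> R) (B : R) :
  (forall n, (1 <= n)%nat -> Rabs (g n) <= B) ->
  exists L : R, is_series (real_series_term (real_id_conv g)) L /\
    forall x : R, 3 <= x ->
      Rabs (real_Ssum (real_id_conv g) x - x * L) <= 400000010 * B * cbrt x * ln x.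
Proof.
  intros Hg.
  assert (HB : 0 <= B) by (apply Rle_trans with (Rabs (g 1%nat)); [apply Rabs_pos|apply Hg; lia]).
  destruct (real_series_tail g B Hg) as [L [HL Htail]]. exists L. split; [easy|].
  intros x Hx. set (X := fl x).
  assert (HX1 : INR X <= x) by (apply fl_ge; [lra|unfold X; lia]).
  assert (HX2 : x < INR (S X)).
  { apply Rnot_le_lt. intros H. apply fl_ge in H; [|lra]. unfold X in H. lia. }
  assert (Hcx : 1 <= cbrt x) by (apply cbrt_ge1; lra).
  assert (Hln : 1 <= ln x).
  { rewrite <- (ln_exp 1). apply ln_le; [apply exp_pos|]. pose proof exp_le_3. lra. }
  assert (Hval : forall n, (n < X)%nat -> (1 <= fl (x / INR (S n)) <= X)%nat).
  { intros n Hn. split; [|apply fl_div_le; [lra|lia]].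
    apply fl_div_swap; [lra|lia|lia|]. replace (x / INR 1) with x by (simpl; field). easy. }
  set (e := fun k => rsum X (fun n => dvd_ind k (fl (x / INR (S n))))
        - x * rsum X (fun m => dvd_ind k (S m) * / (INR (S m) * INR (S (S m))))).
  assert (Emain : real_Ssum (real_id_conv g) x - x * rsum X (real_series_term (real_id_conv g))
     = rsum X (fun k => g (S k) / INR (S k) * e (S k))).
  { unfold e. rewrite (rsum_ext X (fun k => g (S k) / INR (S k) * _)
      (fun k => rsum X (fun n => dvd_ind (S k) (fl (x / INR (S n))) * (g (S k) / INR (S k)))
        - x * rsum X (fun m => / (INR (S m) * INR (S (S m))) * (dvd_ind (S k) (S m) * (g (S k) / INR (S k)))))).
    - rewrite rsum_minus, rsum_scal. f_equal; [|f_equal].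
      + rewrite rsum_switch. unfold real_Ssum. fold X. apply rsum_ext; intros n Hn.
        apply real_id_conv_quotient; apply Hval; easy.
      + rewrite rsum_switch. apply rsum_ext; intros m Hm. rewrite rsum_scal.
        rewrite <- real_id_conv_quotient by lia. unfold real_series_term.
        pose proof (INR_S_pos m). pose proof (INR_S_pos (S m)). field. lra.
    - intros k _. rewrite Rmult_minus_distr_l. f_equal.
      + rewrite <- rsum_scal. apply rsum_ext; intros; ring.
      + rewrite <- Rmult_assoc, (Rmult_comm _ x), Rmult_assoc. f_equal.
        rewrite <- rsum_scal. apply rsum_ext; intros; ring. }
  assert (Hmain : Rabs (rsum X (fun k => g (S k) / INR (S k) * e (S k)))
     <= 400000000 * B * cbrt x * ln x).
  { eapply Rle_trans; [apply rsum_abs|].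
    apply Rle_trans with (rsum X (fun k => 100000000 * B * cbrt x * ln x * / (INR (S k) * cbrt (INR (S k))))).
    - apply rsum_le; intros k Hk. pose proof (INR_pos_ge1 (S k) ltac:(lia)) as Pk.
      assert (Hkx : INR (S k) <= x) by (apply fl_ge; [lra|unfold X in Hk; lia]).
      assert (Hy : 1 <= x / INR (S k)).
      { apply Rmult_le_reg_r with (INR (S k)); [lra|]. unfold Rdiv. rewrite Rmult_assoc, Rinv_l; lra. }
      assert (Hy0 : 0 < x / INR (S k)) by lra.
      pose proof (multiples_error x (cbrt (x / INR (S k))) (S k) ltac:(lia)
        (cbrt_ge1 _ Hy) (cbrt_pow3 _ Hy0)) as D.
      fold X in D. change (Rabs (e (S k)) <= 50000000 * cbrt (x / INR (S k)) * (1 + ln (cbrt (x / INR (S k))))) in D.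
      assert (Hl : ln (cbrt (x / INR (S k))) <= ln x).
      { rewrite ln_cbrt. assert (ln (x / INR (S k)) <= ln x) by (apply ln_le; [lra|apply Rdiv_le_self; lra]). lra. }
      assert (Hc : cbrt (x / INR (S k)) = cbrt x / cbrt (INR (S k))).
      { pose proof (cbrt_pos (INR (S k))).
        replace (cbrt x) with (cbrt (x / INR (S k)) * cbrt (INR (S k))); [field; lra|].
        rewrite <- cbrt_mult by lra. f_equal. field. lra. }
      pose proof (cbrt_pos (x / INR (S k))) as Pc. pose proof (cbrt_pos (INR (S k))) as Pd.
      (* 1 + ln(cbrt) <= 2 ln x because x >= 3 makes ln x >= 1. *)
      assert (D' : Rabs (e (S k)) <= 100000000 * cbrt (x / INR (S k)) * ln x).
      { eapply Rle_trans; [apply D|].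
        apply Rle_trans with (50000000 * cbrt (x / INR (S k)) * (2 * ln x)); [|lra].
        apply Rmult_le_compat_l; lra. }
      rewrite Rabs_mult, Rabs_div, (Rabs_right (INR (S k))) by lra.
      apply Rle_trans with (B / INR (S k) * (100000000 * cbrt (x / INR (S k)) * ln x)).
      + apply Rmult_le_compat; [apply Rdiv_le_0_compat; [apply Rabs_pos|lra]|apply Rabs_pos| |easy].
        apply Rmult_le_compat_r; [apply Rlt_le, Rinv_0_lt_compat; lra|apply Hg; lia].
      + right. rewrite Hc. field. lra.
    - rewrite rsum_scal. pose proof (sum_four_thirds X).
      apply Rle_trans with (100000000 * B * cbrt x * ln x * 4); [|lra].
      apply Rmult_le_compat_l; [|easy]. repeat apply Rmult_le_pos; lra. }
  (* The tail beyond x is O(ln x / x), so x times it is only O(ln x). *)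
  assert (HT : x * Rabs (L - rsum X (real_series_term (real_id_conv g))) <= 10 * B * cbrt x * ln x).
  { apply Rle_trans with (x * (B * ((harmonic (S X) + 1) / INR (S X)))); [apply Rmult_le_compat_l; [lra|apply Htail]|].
    pose proof (harmonic_le_ln X) as Hh.
    assert (H1 : ln (INR (S X)) <= 2 * ln x).
    { replace (2 * ln x) with (ln (x * x)) by (rewrite ln_mult by lra; ring).
      apply ln_le; [lra|]. rewrite S_INR. nra. }
    assert (H0 : 0 <= harmonic (S X)).
    { apply rsum_nonneg; intros. apply Rlt_le, Rinv_0_lt_compat, INR_S_pos. }
    assert (H2 : x / INR (S X) <= 1).
    { apply Rmult_le_reg_r with (INR (S X)); [lra|]. unfold Rdiv. rewrite Rmult_assoc, Rinv_l; lra. }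
    replace (x * (B * ((harmonic (S X) + 1) / INR (S X)))) with (B * (harmonic (S X) + 1) * (x / INR (S X)))
      by (field; lra).
    apply Rle_trans with (B * (harmonic (S X) + 1) * 1); [apply Rmult_le_compat_l; [apply Rmult_le_pos; lra|easy]|].
    replace (10 * B * cbrt x * ln x) with (B * (10 * (cbrt x * ln x))) by ring.
    rewrite Rmult_1_r. apply Rmult_le_compat_l; [easy|]. nra. }
  replace (real_Ssum (real_id_conv g) x - x * L)
    with ((real_Ssum (real_id_conv g) x - x * rsum X (real_series_term (real_id_conv g)))
          - x * (L - rsum X (real_series_term (real_id_conv g)))) by ring.
  rewrite Emain. unfold Rminus at 1. eapply Rle_trans; [apply Rabs_triang|].
  rewrite Rabs_Ropp, Rabs_mult, (Rabs_right x) by lra. lra.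
Qed.

(** * Complex-valued g *)

(** Covers real and imaginary parts at once, so that the reduction to real g is carried out a single
    time. *)
Definition R_linear (p : C -> R) : Prop :=
  (forall z w, p (Cplus z w) = p z + p w) /\ (forall (r : R) z, p (Cmult (RtoC r) z) = r * p z).

Lemma fst_R_linear : R_linear fst.
Proof. split; intros; simpl; ring. Qed.

Lemma snd_R_linear : R_linear snd.
Proof. split; intros; simpl; ring. Qed.

Lemma R_linear_div (p : C -> R) (z : C) (r : R) : R_linear p -> r <> 0 ->
  p (Cdiv z (RtoC r)) = p z / r.
Proof.
  intros [_ Hs] Hr. unfold Cdiv. rewrite <- RtoC_inv, Cmult_comm, Hs by easy.
  unfold Rdiv. ring.
Qed.

Lemma R_linear_0 (p : C -> R) : R_linear p -> p (RtoC 0) = 0.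
Proof.
  intros [_ Hs]. rewrite <- (Cmult_0_l (RtoC 0)), Hs. ring.
Qed.

Lemma R_linear_sum (p : C -> R) (F : nat -> C) (n : nat) : R_linear p ->
  p (fold_right Cplus (RtoC 0) (map F (seq 1 n))) = rsum n (fun i => p (F (S i))).
Proof.
  intros Hp. transitivity (fold_right Rplus 0 (map (fun m => p (F m)) (seq 1 n))).
  2: { rewrite rsum_seq. easy. }
  induction (seq 1 n) as [|a l IH]; simpl; [apply R_linear_0; easy|].
  destruct Hp as [Ha Hs]. rewrite Ha, IH. easy.
Qed.

Lemma R_linear_id_conv (p : C -> R) (g : nat -> C) (n : nat) : R_linear p ->
  p (id_conv g n) = real_id_conv (fun k => p (g k)) n.
Proof.
  intros Hp. unfold id_conv. rewrite R_linear_sum by easy.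
  apply rsum_ext; intros d _. unfold dvd_ind. destruct (Nat.eqb _ _).
  - rewrite (proj2 Hp). ring.
  - rewrite R_linear_0 by easy. ring.
Qed.

Lemma R_linear_series_term (p : C -> R) (g : nat -> C) (k : nat) : R_linear p ->
  p (series_term (id_conv g) k) = real_series_term (real_id_conv (fun k => p (g k))) k.
Proof.
  intros Hp. unfold series_term, real_series_term.
  pose proof (INR_S_pos k). pose proof (INR_S_pos (S k)).
  rewrite R_linear_div, R_linear_id_conv; [easy|easy|easy|].
  apply Rmult_integral_contrapositive_currified; [apply pow_nonzero|]; lra.
Qed.

Lemma R_linear_Ssum (p : C -> R) (g : nat -> C) (x : R) : R_linear p -> 0 <= x ->
  p (Ssum (id_conv g) x) = real_Ssum (real_id_conv (fun k => p (g k))) x.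
Proof.
  intros Hp Hx. unfold Ssum, real_Ssum. rewrite R_linear_sum by easy.
  apply rsum_ext; intros n Hn.
  assert (1 <= fl (x / INR (S n)))%nat.
  { apply fl_div_swap; [lra|lia|lia|]. replace (x / INR 1) with x by (simpl; field). easy. }
  rewrite R_linear_div, R_linear_id_conv; [easy|easy|easy|]. apply not_0_INR. lia.
Qed.

(** Balls in [C] are products of balls in the two coordinates. *)
Lemma is_series_C (a : nat -> C) (u v : R) :
  is_series (fun k => fst (a k)) u -> is_series (fun k => snd (a k)) v ->
  is_series a (u, v).
Proof.
  intros Hu Hv. apply filterlim_locally. intros eps.
  pose proof (proj1 (filterlim_locally _ _) Hu eps) as Eu.
  pose proof (proj1 (filterlim_locally _ _) Hv eps) as Ev.
  assert (Ef : forall n, fst (sum_n a n) = sum_n (fun k => fst (a k)) n).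
  { induction n as [|n IH]; [rewrite !sum_O; easy|]. rewrite !sum_Sn, <- IH. easy. }
  assert (Es : forall n, snd (sum_n a n) = sum_n (fun k => snd (a k)) n).
  { induction n as [|n IH]; [rewrite !sum_O; easy|]. rewrite !sum_Sn, <- IH. easy. }
  generalize (filter_and _ _ Eu Ev). apply filter_imp. intros n [H1 H2].
  split; [rewrite Ef|rewrite Es]; easy.
Qed.

Lemma Cmod_le_sum (z : C) : Cmod z <= Rabs (fst z) + Rabs (snd z).
Proof.
  unfold Cmod. pose proof (Rabs_pos (fst z)). pose proof (Rabs_pos (snd z)).
  rewrite <- (sqrt_pow2 (Rabs (fst z) + Rabs (snd z))) by lra.
  apply sqrt_le_1_alt. rewrite <- (pow2_abs (fst z)), <- (pow2_abs (snd z)). nra.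
Qed.

Theorem theorem1p1 (g : nat -> C) (B : R)
  (hg : forall n : nat, (1 <= n)%nat -> Cmod (g n) <= B) :
  exists L : C,
    is_series (series_term (id_conv g)) L /\
    exists K x0 : R, forall x : R, x0 <= x ->
      Cmod (Cminus (Ssum (id_conv g) x) (Cmult (RtoC x) L))
        <= K * Rpower x (1/3) * ln x.
Proof.
  (* Real and imaginary parts are bounded by the modulus, so the same B serves both. *)
  destruct (real_Ssum_asymptotics (fun k => fst (g k)) B) as [u [Hu Bu]].
  { intros n Hn. eapply Rle_trans; [|apply (hg n Hn)].
    eapply Rle_trans; [apply Rmax_l|apply Rmax_Cmod]. }
  destruct (real_Ssum_asymptotics (fun k => snd (g k)) B) as [v [Hv Bv]].
  { intros n Hn. eapply Rle_trans; [|apply (hg n Hn)].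
    eapply Rle_trans; [apply Rmax_r|apply Rmax_Cmod]. }
  exists (u, v). split.
  - apply is_series_C.
    + eapply is_series_ext; [|apply Hu]. intros k. symmetry.
      apply R_linear_series_term, fst_R_linear.
    + eapply is_series_ext; [|apply Hv]. intros k. symmetry.
      apply R_linear_series_term, snd_R_linear.
  (* The factor 2 adds the two coordinate errors, and 3 is the threshold of the real case. *)
  - exists (2 * 400000010 * B), 3. intros x Hx.
    specialize (Bu x Hx). specialize (Bv x Hx).
    rewrite <- R_linear_Ssum in Bu by (apply fst_R_linear || lra).
    rewrite <- R_linear_Ssum in Bv by (apply snd_R_linear || lra).
    eapply Rle_trans; [apply Cmod_le_sum|].
    replace (fst (Cminus (Ssum (id_conv g) x) (Cmult (RtoC x) (u, v))))
      with (fst (Ssum (id_conv g) x) - x * u) by (simpl; ring).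
    replace (snd (Cminus (Ssum (id_conv g) x) (Cmult (RtoC x) (u, v))))
      with (snd (Ssum (id_conv g) x) - x * v) by (simpl; ring).
    unfold cbrt in Bu, Bv. lra.
Qed.
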